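(* Let $k$ be a commutative ring with unity and take $q=-1$. Then $\varsigma_T:=\pi'_{-1}(c_{-1}(T))$ lies in $\mathsf{OSym}=\mathsf{Sym}_{-1}$ for every standard Young tableau $T$. Consequently $\pi'_{-1}$ restricts to a surjection from $\mathsf{PR}'_{-1}$ onto $\mathsf{OSym}$.
   Context: **Compositions.** For a composition $\alpha=(\alpha_1,\dots,\alpha_r)$ of $n$, $\mathrm{des}(\alpha)=\{\alpha_1,\dots,\alpha_1+\cdots+\alpha_{r-1}\}\subseteq[n-1]$; for $S\subseteq[n-1]$, $c(S)$ is the composition of $n$ with descent set $S$. $\alpha\preceq\beta$ means $\beta$ is a refinement of $\alpha$. **Functions.** Let $A_{-1}=k\langle\langle x_1,x_2,\dots\rangle\rangle/(x_ix_j+x_jx_i,\ i>j)$, $M_\alpha=\sum_{i_1<\cdots<i_r}x_{i_1}^{\alpha_1}\cdots x_{i_r}^{\alpha_r}$, $F_\alpha=\sum_{\beta\succeq\alpha}M_\beta$. $\mathsf{QSym}_{-1}$ is the subalgebra of $A_{-1}$ with basis $\{M_\alpha\}$, and $\mathsf{OSym}=\mathsf{Sym}_{-1}$ is its subalgebra generated by $h_n=\sum_{i_1\le\cdots\le i_n}x_{i_1}\cdots x_{i_n}$, $n\ge1$. **Permutations and tableaux.** For $w\in\mathfrak{S}_n$ (a word $w_1\cdots w_n$), $\ell(w)$ is the number of inversions and $c(w)=c(\{i\in[n-1]:w(i)>w(i+1)\})$. $P(w)$ is the Schensted row-insertion tableau of $w$. For a standard Young tableau $T$, $c_q(T)=\sum_{P(w)=T}q^{\ell(w)}w\in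 k\mathfrak{S}=\bigoplus_nk\mathfrak{S}_n$. $\mathsf{PR}'_q=\bigoplus_Tk\cdot c_q(T)\subseteq k\mathfrak{S}$. The linear map $\pi'_q:k\mathfrak{S}\to\mathsf{QSym}_q$ is $\pi'_q(w)=F_{c(w)}$. Thus $\varsigma_T=\sum_{P(w)=T}(-1)^{\ell(w)}F_{c(w)}$. *)

(* Defs.v *)
From HB Require Import structures.
From mathcomp Require Import all_boot all_order all_algebra all_fingroup.
From mathcomp Require Import generic_quotient ring_quotient finmap.
From mathcomp Require Import boolp classical_sets functions.
From mathcomp Require Import monalg.

Set Implicit Arguments.
Unset Strict Implicit.
Unset Printing Implicit Defensive.

Import GRing.Theory.

Local Open Scope ring_scope.
Local Open Scope quotient_scope.

Definition is_composition (n : nat) (a : seq nat) : bool :=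
  all (fun m => 0 < m)%N a && (sumn a == n).

Definition des_comp (a : seq nat) : seq nat :=
  [seq sumn (take i a) | i <- iota 1 (size a).-1].

(* A subset of [n-1] = {1, .., n-1} is encoded as S : {set 'I_n.-1}, where
   i : 'I_n.-1 stands for i + 1; [cuts S] lists it in increasing order. *)
Definition cuts n (S : {set 'I_n.-1}) : seq nat :=
  [seq (val i).+1 | i <- enum S].

Definition comp_of_set n (S : {set 'I_n.-1}) : seq nat :=
  if n is 0 then [::]
  else pairmap (fun a b => b - a)%N 0%N (rcons (cuts S) n).

Lemma cuts_sorted n (S : {set 'I_n.-1}) : sorted ltn (cuts S).
Proof.
rewrite sorted_map /enum_mem sorted_filter //.
  by move=> ? ? ?; exact: ltn_trans.
rewrite -enumT; have := iota_ltn_sorted 0 n.-1.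
by rewrite -val_enum_ord sorted_map; apply: sub_sorted.
Qed.

Lemma cuts_path n (S : {set 'I_n.-1}) : (0 < n)%N -> path ltn 0%N (rcons (cuts S) n).
Proof.
move=> n_gt0; have cutsP m : m \in cuts S -> (0 < m < n)%N.
  by case/mapP => i _ ->; rewrite /= -ltn_predRL ltn_ord.
rewrite rcons_path (path_sortedE ltn_trans) cuts_sorted andbT; apply/andP; split.
  by apply/allP => m /cutsP/andP[].
case: (lastP (cuts S)) cutsP => [//|c m cP].
have /andP[_] : (0 < m < n)%N by apply: cP; rewrite mem_rcons mem_head.
by rewrite last_rcons.
Qed.

(* The two properties that characterize c(S). *)
Lemma comp_of_setP n (S : {set 'I_n.-1}) :
  is_composition n (comp_of_set S) /\ des_comp (comp_of_set S) = cuts S.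
Proof.
have sumE s x i : path ltn x s -> (i <= size s)%N ->
    (x + sumn (take i (pairmap (fun a b => b - a)%N x s)))%N = nth 0%N (x :: s) i.
  elim: s x i => [|y s IHs] x [|i] //=; rewrite ?addn0 // => /andP[xy ys] si.
  by rewrite addnA subnKC ?IHs // ltnW.
rewrite /comp_of_set; case: n S => [|n] S.
  by split=> //; rewrite /cuts; case: (enum S) => [//|[]].
have cP := cuts_path S (ltn0Sn n); set c := rcons _ _ in cP *.
have sz : size (pairmap (fun a b => b - a)%N 0%N c) = (size (cuts S)).+1.
  by rewrite size_pairmap size_rcons.
split.
  apply/andP; split.
    have posP (x : nat) s : path ltn x s ->
        all (fun m => 0 < m)%N (pairmap (fun a b => b - a)%N x s).
      elim: s x => [//|y s IHs] x /= /andP[xy ys].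
      by rewrite subn_gt0 xy IHs.
    exact: posP.
  rewrite -[pairmap _ _ _]take_size sz -[sumn _]add0n sumE //; last first.
    by rewrite size_rcons.
  by rewrite /= nth_rcons ltnn eqxx.
rewrite /des_comp sz /=.
apply: (@eq_from_nth _ 0%N); rewrite ?size_map ?size_iota // => i ic.
rewrite (nth_map 0%N) ?size_iota // nth_iota // -[sumn _]add0n sumE //=.
  by rewrite nth_rcons size_map ic.
by rewrite size_rcons ltnS size_map ltnW.
Qed.

(* b is obtained from a by replacing each part of a with a composition of that
   part (for a and b with positive parts). *)
Definition refines (b a : seq nat) : Prop :=
  exists ss : seq (seq nat), b = flatten ss /\ a = [seq sumn s | s <- ss].

(* A noncommutative power series in x_0, x_1, x_2, ... is its coefficient
   function on words; [:: i1; ..; ir] is the monomial x_i1 ... x_ir.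
   Variables are numbered from 0 instead of 1. *)
Definition ncseries (k : comPzRingType) : Type := seq nat -> k.

Section NCSeries.
Variable k : comPzRingType.
Local Notation S := (ncseries k).
Implicit Types (f g h : S) (a b : k) (w : seq nat).

HB.instance Definition _ := gen_eqMixin S.
HB.instance Definition _ := gen_choiceMixin S.

Definition nc_zero : S := fun=> 0.
Definition nc_opp f : S := fun w => - f w.
Definition nc_add f g : S := fun w => f w + g w.
Definition nc_one : S := fun w => (w == [::])%:R.
Definition nc_mul f g : S :=
  fun w => \sum_(i < (size w).+1) f (take i w) * g (drop i w).
Definition nc_scale a f : S := fun w => a * f w.
Definition nc_var (i : nat) : S := fun w => (w == [:: i])%:R.

Fact nc_addA : associative nc_add.
Proof. by move=> f g h; apply/funext => w; rewrite /nc_add addrA. Qed.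
Fact nc_addC : commutative nc_add.
Proof. by move=> f g; apply/funext => w; rewrite /nc_add addrC. Qed.
Fact nc_add0 : left_id nc_zero nc_add.
Proof. by move=> f; apply/funext => w; rewrite /nc_add add0r. Qed.
Fact nc_addN : left_inverse nc_zero nc_opp nc_add.
Proof. by move=> f; apply/funext => w; rewrite /nc_add addNr. Qed.

HB.instance Definition _ :=
  GRing.isZmodule.Build S nc_addA nc_addC nc_add0 nc_addN.

Definition nc_cut (x : nat) f : S := fun w => f (x :: w).

Fact nc_mul_nil f g : nc_mul f g [::] = f [::] * g [::].
Proof. by rewrite /nc_mul big_ord1. Qed.

Fact nc_mul_cons f g x w :
  nc_mul f g (x :: w) = f [::] * g (x :: w) + nc_mul (nc_cut x f) g w.
Proof. by rewrite /nc_mul big_ord_recl. Qed.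

Fact nc_mul1l : left_id nc_one nc_mul.
Proof.
move=> f; apply/funext => w; rewrite /nc_mul big_ord_recl take0 drop0 mul1r.
rewrite big1 ?addr0 // => i _; case: w i => [[]//|x w i].
exact: mul0r.
Qed.

Fact nc_mul1r : right_id nc_one nc_mul.
Proof.
move=> f; apply/funext => w; rewrite /nc_mul big_ord_recr /= take_size drop_size.
rewrite mulr1 big1 ?add0r // => i _.
by rewrite /nc_one -size_eq0 size_drop subn_eq0 leqNgt ltn_ord mulr0.
Qed.

Fact nc_mulDl : left_distributive nc_mul nc_add.
Proof.
move=> f g h; apply/funext => w; rewrite /nc_add /nc_mul -big_split.
by apply: eq_bigr => i _; rewrite mulrDl.
Qed.

Fact nc_mulDr : right_distributive nc_mul nc_add.
Proof.
move=> f g h; apply/funext => w; rewrite /nc_add /nc_mul -big_split.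
by apply: eq_bigr => i _; rewrite mulrDr.
Qed.

Fact nc_scaleAl a f g : nc_scale a (nc_mul f g) = nc_mul (nc_scale a f) g.
Proof.
apply/funext => w; rewrite /nc_scale /nc_mul mulr_sumr.
by apply: eq_bigr => i _; rewrite mulrA.
Qed.

Fact nc_scaleAr a f g : nc_scale a (nc_mul f g) = nc_mul f (nc_scale a g).
Proof.
apply/funext => w; rewrite /nc_scale /nc_mul mulr_sumr.
by apply: eq_bigr => i _; rewrite mulrCA.
Qed.

Fact nc_mulA : associative nc_mul.
Proof.
move=> f g h; apply/funext => w; elim: w f => [|x w IHw] f.
  by rewrite !nc_mul_nil mulrA.
rewrite !nc_mul_cons IHw nc_mul_nil.
have -> : nc_cut x (nc_mul f g) = nc_add (nc_scale (f [::]) (nc_cut x g)) (nc_mul (nc_cut x f) g).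
  by apply/funext => v; rewrite /nc_cut nc_mul_cons.
by rewrite nc_mulDl -nc_scaleAl /nc_add /nc_scale mulrDr addrA mulrA.
Qed.

HB.instance Definition _ := GRing.Zmodule_isPzRing.Build S
  nc_mulA nc_mul1l nc_mul1r nc_mulDl nc_mulDr.

Fact nc_scaleA a b f : nc_scale a (nc_scale b f) = nc_scale (a * b) f.
Proof. by apply/funext => w; rewrite /nc_scale mulrA. Qed.
Fact nc_scale1 : left_id 1 nc_scale.
Proof. by move=> f; apply/funext => w; rewrite /nc_scale mul1r. Qed.
Fact nc_scaleDr : right_distributive nc_scale +%R.
Proof. by move=> a f g; apply/funext => w; rewrite /nc_scale mulrDr. Qed.
Fact nc_scaleDl f : {morph nc_scale^~ f : a b / a + b}.
Proof. by move=> a b; apply/funext => w; rewrite /nc_scale mulrDl. Qed.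

HB.instance Definition _ := GRing.Zmodule_isLmodule.Build k S
  nc_scaleA nc_scale1 nc_scaleDr nc_scaleDl.

(* The ideal must be closed for coefficientwise convergence (k being discrete):
   h_1 ^+ 2 = M_(2) in A_{-1} only because the infinite sum
   \sum_(i > j) (x_i x_j + x_j x_i) vanishes there. *)
Definition closed_ideal (J : set S) : Prop :=
  [/\ J 0, forall f g, J f -> J g -> J (f + g),
      forall f g, J g -> J (f * g) /\ J (g * f)
    & forall f, (forall W : seq (seq nat),
        exists2 g, J g & {in W, forall w, g w = f w}) -> J f].

Definition anticomm_relators : set S :=
  [set r | exists i j : nat, (j < i)%N /\
     r = nc_var i * nc_var j + nc_var j * nc_var i]%classic.

Definition anticomm_ideal : {pred S} :=
  [pred f | `[< smallest closed_ideal anticomm_relators f >]].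

Lemma closed_idealZ (J : set S) a f : closed_ideal J -> J f -> J (a *: f).
Proof.
move=> [_ _ JM _] Jf; have -> : a *: f = (a *: (1 : S)) * f; last exact: (JM _ _ Jf).1.
by rewrite -[in LHS](mul1r f); exact: nc_scaleAl.
Qed.

Lemma smallest_closed_ideal : closed_ideal (smallest closed_ideal anticomm_relators).
Proof.
split.
- by move=> J [[]].
- move=> f g If Ig J JP; have [[_ JD _ _] _] := JP.
  by apply: JD; [exact: If | exact: Ig].
- move=> f g Ig; split=> J JP; have [[_ _ JM _] _] := JP.
    exact: (JM f g (Ig J JP)).1.
  exact: (JM f g (Ig J JP)).2.
- move=> f fP J JP; have [[_ _ _ JC] _] := JP; apply: JC => W.
  by have [g Ig gf] := fP W; exists g => //; exact: Ig.
Qed.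

Lemma anticomm_idealP f :
  reflect (smallest closed_ideal anticomm_relators f) (f \in anticomm_ideal).
Proof. exact: asboolP. Qed.

Fact anticomm_ideal_zmod_closed : zmod_closed anticomm_ideal.
Proof.
have IP := smallest_closed_ideal; have [I0 ID _ _] := IP.
split=> [|f g /anticomm_idealP If /anticomm_idealP Ig]; apply/anticomm_idealP.
  exact: I0.
apply: ID => //; rewrite -scaleN1r; exact: (closed_idealZ (-1) IP Ig).
Qed.

HB.instance Definition _ :=
  GRing.isZmodClosed.Build S anticomm_ideal anticomm_ideal_zmod_closed.

Lemma anticomm_idealMl f g : g \in anticomm_ideal -> f * g \in anticomm_ideal.
Proof.
have [_ _ IM _] := smallest_closed_ideal.
by move=> /anticomm_idealP Ig; apply/anticomm_idealP; exact: (IM f g Ig).1.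
Qed.

Lemma anticomm_idealMr f g : g \in anticomm_ideal -> g * f \in anticomm_ideal.
Proof.
have [_ _ IM _] := smallest_closed_ideal.
by move=> /anticomm_idealP Ig; apply/anticomm_idealP; exact: (IM f g Ig).2.
Qed.

Lemma anticomm_idealZ a f : f \in anticomm_ideal -> a *: f \in anticomm_ideal.
Proof.
move=> /anticomm_idealP If; apply/anticomm_idealP.
exact: (closed_idealZ a smallest_closed_ideal If).
Qed.

(* A_{-1} = k<<x_0, x_1, ..>> / (x_i x_j + x_j x_i, i > j). *)
Definition oddA : Type := {ideal_quot anticomm_ideal}.

HB.instance Definition _ := GRing.Zmodule.on oddA.
HB.instance Definition _ := Quotient.on oddA.

Definition oddA_pi (f : S) : oddA := \pi_oddA f.

Lemma oddA_piP f g : (oddA_pi f = oddA_pi g) <-> (f - g \in anticomm_ideal).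
Proof.
split=> [/eqP|fg]; first by rewrite -Quotient.idealrBE.
by apply/eqP; rewrite -Quotient.idealrBE.
Qed.

Lemma oddA_piD f g : oddA_pi (f + g) = oddA_pi f + oddA_pi g.
Proof. exact: Quotient.pi_add. Qed.

Definition oddA_one : oddA := oddA_pi 1.
Definition oddA_mul (u v : oddA) : oddA := oddA_pi (repr u * repr v).
Definition oddA_scale a (u : oddA) : oddA := oddA_pi (a *: repr u).

Fact oddA_reprE f : f - repr (oddA_pi f) \in anticomm_ideal.
Proof. by apply/oddA_piP; rewrite /oddA_pi reprK. Qed.

Fact oddA_piM_sub f g : oddA_mul (oddA_pi f) (oddA_pi g) = oddA_pi (f * g).
Proof.
apply/esym/oddA_piP.
rewrite -[f * g](subrK (f * repr (oddA_pi g))) -mulrBr -addrA -mulrBl.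
by apply: rpredD; [apply: anticomm_idealMl | apply: anticomm_idealMr]; exact: oddA_reprE.
Qed.

Fact oddA_piZ_sub a f : oddA_scale a (oddA_pi f) = oddA_pi (a *: f).
Proof. by apply/esym/oddA_piP; rewrite -scalerBr; exact/anticomm_idealZ/oddA_reprE. Qed.

Fact oddA_ind (P : oddA -> Prop) : (forall f, P (oddA_pi f)) -> forall u, P u.
Proof. by move=> Pf u; rewrite -[u]reprK; exact: Pf. Qed.

Fact oddA_mulA : associative oddA_mul.
Proof.
elim/oddA_ind => f; elim/oddA_ind => g; elim/oddA_ind => h.
by rewrite !oddA_piM_sub mulrA.
Qed.
Fact oddA_mul1l : left_id oddA_one oddA_mul.
Proof. by elim/oddA_ind => f; rewrite oddA_piM_sub mul1r. Qed.
Fact oddA_mul1r : right_id oddA_one oddA_mul.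
Proof. by elim/oddA_ind => f; rewrite oddA_piM_sub mulr1. Qed.
Fact oddA_mulDl : left_distributive oddA_mul +%R.
Proof.
elim/oddA_ind => f; elim/oddA_ind => g; elim/oddA_ind => h.
by rewrite -oddA_piD !oddA_piM_sub mulrDl oddA_piD.
Qed.
Fact oddA_mulDr : right_distributive oddA_mul +%R.
Proof.
elim/oddA_ind => f; elim/oddA_ind => g; elim/oddA_ind => h.
by rewrite -oddA_piD !oddA_piM_sub mulrDr oddA_piD.
Qed.

HB.instance Definition _ := GRing.Zmodule_isPzRing.Build oddA
  oddA_mulA oddA_mul1l oddA_mul1r oddA_mulDl oddA_mulDr.

Fact oddA_scaleA a b u : oddA_scale a (oddA_scale b u) = oddA_scale (a * b) u.
Proof. by elim/oddA_ind: u => f; rewrite !oddA_piZ_sub scalerA. Qed.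
Fact oddA_scale1 : left_id 1 oddA_scale.
Proof. by elim/oddA_ind => f; rewrite oddA_piZ_sub scale1r. Qed.
Fact oddA_scaleDr : right_distributive oddA_scale +%R.
Proof.
move=> a; elim/oddA_ind => f; elim/oddA_ind => g.
by rewrite -oddA_piD !oddA_piZ_sub scalerDr oddA_piD.
Qed.
Fact oddA_scaleDl u : {morph oddA_scale^~ u : a b / a + b}.
Proof.
by elim/oddA_ind: u => f a b; rewrite !oddA_piZ_sub scalerDl oddA_piD.
Qed.

HB.instance Definition _ := GRing.Zmodule_isLmodule.Build k oddA
  oddA_scaleA oddA_scale1 oddA_scaleDr oddA_scaleDl.

Lemma oddA_piM f g : oddA_pi (f * g) = oddA_pi f * oddA_pi g.
Proof. exact/esym/oddA_piM_sub. Qed.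

Lemma oddA_piZ a f : oddA_pi (a *: f) = a *: oddA_pi f.
Proof. exact/esym/oddA_piZ_sub. Qed.

Lemma oddA_scalerAl a (u v : oddA) : a *: (u * v) = (a *: u) * v.
Proof.
elim/oddA_ind: u => f; elim/oddA_ind: v => g.
rewrite -oddA_piM -!oddA_piZ -oddA_piM; congr oddA_pi; exact: nc_scaleAl.
Qed.

Lemma oddA_scalerAr a (u v : oddA) : a *: (u * v) = u * (a *: v).
Proof.
elim/oddA_ind: u => f; elim/oddA_ind: v => g.
rewrite -oddA_piM -!oddA_piZ -oddA_piM; congr oddA_pi; exact: nc_scaleAr.
Qed.

(* The parts of a being positive, distinct increasing sequences i1 < .. < ir
   give distinct words i1^a1 ... ir^ar, so all coefficients are 0 or 1. *)
Definition monomial_qsym (a : seq nat) : oddA :=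
  oddA_pi (fun w => `[< exists i : seq nat,
    [/\ sorted ltn i, size i = size a
      & w = flatten [seq nseq p.1 p.2 | p <- zip a i]] >]%:R).

Definition fundamental_qsym (a : seq nat) : oddA :=
  \sum_(D : {set 'I_(sumn a).-1} | `[< refines (comp_of_set D) a >])
     monomial_qsym (comp_of_set D).

Definition complete_sym (n : nat) : oddA :=
  oddA_pi (fun w => ((size w == n) && sorted leq w)%:R).

Definition is_subalgebra (B : set oddA) : Prop :=
  [/\ B 1, forall a u v, B u -> B v -> B (a *: u + v)
    & forall u v, B u -> B v -> B (u * v)].

(* QSym_{-1} is itself a subalgebra of A_{-1}, so generating inside A_{-1} or
   inside QSym_{-1} gives the same algebra. *)
Definition OSym : set oddA :=
  smallest is_subalgebra
    [set h | exists2 n, (0 < n)%N & h = complete_sym n]%classic.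

End NCSeries.

Arguments OSym k : clear implicits.

(* The word w_1 ... w_n has letters in {1, .., n}, while 'S_n acts on
   {0, .., n-1}. *)
Definition perm_word n (s : 'S_n) : seq nat :=
  [seq (val (s i)).+1 | i <- enum 'I_n].

Definition perm_inv n (s : 'S_n) : nat :=
  #|[set p : 'I_n * 'I_n | (p.1 < p.2)%N && (s p.2 < s p.1)%N]|.

Definition perm_comp n (s : 'S_n) : seq nat :=
  comp_of_set [set i : 'I_n.-1 |
    (nth 0%N (perm_word s) i.+1 < nth 0%N (perm_word s) i)%N].

(* Returns the bumped entry, if any, and the new row. *)
Fixpoint row_insert (x : nat) (r : seq nat) : option nat * seq nat :=
  if r is y :: r' then
    if (x < y)%N then (Some y, x :: r')
    else let: (b, r1) := row_insert x r' in (b, y :: r1)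
  else (None, [:: x]).

Fixpoint tableau_insert (x : nat) (T : seq (seq nat)) : seq (seq nat) :=
  if T is r :: T' then
    let: (b, r1) := row_insert x r in
    r1 :: (if b is Some y then tableau_insert y T' else T')
  else [:: [:: x]].

Definition schensted (w : seq nat) : seq (seq nat) :=
  foldl (fun T x => tableau_insert x T) [::] w.

(* A tableau is its list of rows, from the top (longest) one down. *)
Definition is_syt (T : seq (seq nat)) : bool :=
  [&& perm_eq (flatten T) (iota 1 (size (flatten T))),
      all (fun r => 0 < size r)%N T, all (sorted ltn) T
    & sorted (fun r r' => (size r' <= size r)%N &&
                          all (fun p => p.1 < p.2)%N (zip r r')) T].

Section PermModule.
Variable k : comPzRingType.

(* \bigoplus_(n >= 0) k S_n, as finitely supported functions on the disjoint
   union of the S_n. *)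
Definition permMod : Type := {malg k[{n : nat & 'S_n}]}.

HB.instance Definition _ := GRing.Zmodule.on permMod.

Definition permMod_scale (a : k) (f : permMod) : permMod :=
  \sum_(s <- msupp f) << a * f@_s *g s >>.

Fact permMod_scaleE a f s : (permMod_scale a f)@_s = a * f@_s.
Proof.
rewrite {2}[f]monalgE !raddf_sum mulr_sumr.
by apply/eq_bigr=> /= i _; rewrite !mcoeffU mulrnAr.
Qed.

Fact permMod_scaleA a b f :
  permMod_scale a (permMod_scale b f) = permMod_scale (a * b) f.
Proof. by apply/malgP => s; rewrite !permMod_scaleE mulrA. Qed.
Fact permMod_scale1 : left_id 1 permMod_scale.
Proof. by move=> f; apply/malgP => s; rewrite permMod_scaleE mul1r. Qed.
Fact permMod_scaleDr : right_distributive permMod_scale +%R.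
Proof.
by move=> a f g; apply/malgP => s; rewrite mcoeffD !permMod_scaleE mcoeffD mulrDr.
Qed.
Fact permMod_scaleDl f : {morph permMod_scale^~ f : a b / a + b}.
Proof.
by move=> a b; apply/malgP => s; rewrite mcoeffD !permMod_scaleE mulrDl.
Qed.

HB.instance Definition _ := GRing.Zmodule_isLmodule.Build k permMod
  permMod_scaleA permMod_scale1 permMod_scaleDr permMod_scaleDl.

Definition perm_elt n (s : 'S_n) : permMod := << Tagged (fun m => 'S_m) s >>.

Definition tableau_sum (q : k) (T : seq (seq nat)) : permMod :=
  \sum_(s : 'S_(size (flatten T)) | schensted (perm_word s) == T)
     q ^+ perm_inv s *: perm_elt s.

Definition PR' (q : k) : set permMod :=
  [set f | exists (Ts : seq (seq (seq nat))) (a : seq (seq nat) -> k),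
     all is_syt Ts /\ f = \sum_(T <- Ts) a T *: tableau_sum q T]%classic.

(* pi'_{-1}, with QSym_{-1} seen inside A_{-1}. *)
Definition pi' (f : permMod) : oddA k :=
  \sum_(s <- msupp f) f@_s *: fundamental_qsym k (perm_comp (tagged s)).

Fact pi'_is_linear : linear pi'.
Proof.
have piE (D : {fset {n : nat & 'S_n}}) f : (msupp f `<=` D)%fset ->
    pi' f = \sum_(s <- D) f@_s *: fundamental_qsym k (perm_comp (tagged s)).
  move=> fD; apply: big_fset_incl => // s _ sf.
  by rewrite mcoeff_outdom // scale0r.
move=> a f g; set D := (msupp (a *: f + g) `|` (msupp f `|` msupp g))%fset.
rewrite !(piE D) ?fsubsetUl //; first last.
- by rewrite /D fsetUCA fsubsetUl.
- by rewrite /D !fsetUA fsubsetUr.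
rewrite scaler_sumr -big_split; apply: eq_bigr => s _ /=.
by rewrite mcoeffD [(a *: f)@_s]permMod_scaleE scalerDl scalerA.
Qed.

HB.instance Definition _ :=
  GRing.isLinear.Build k permMod (oddA k) *:%R pi' pi'_is_linear.

Lemma pi'_perm n (s : 'S_n) :
  pi' (perm_elt s) = fundamental_qsym k (perm_comp s).
Proof.
rewrite /pi' /perm_elt (big_fset_incl _ (msuppU_le)) ?big_seq_fset1 /=.
  by rewrite mcoeffUU scale1r.
by move=> t _ /mcoeff_outdom ->; rewrite scale0r.
Qed.

Definition varsigma (T : seq (seq nat)) : oddA k := pi' (tableau_sum (-1) T).

End PermModule.

Arguments pi' k : clear implicits.

(* Main.v *)
Require Import Defs.
From mathcomp Require Import all_boot all_algebra all_fingroup zify.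
From mathcomp Require Import boolp classical_sets functions.

Set Implicit Arguments.
Unset Strict Implicit.
Unset Printing Implicit Defensive.

Import GRing.Theory.

(** Write sigma_T for the sum of (-1)^l(w) F_{c(w)} over the permutations w with P(w) = T.

    Sorting a word of anticommuting letters costs one sign per inversion, so the words
    that w sorts stably sum to (-1)^l(w) F_{c(w)} ([standard_series]). A product h_a =
    h_{a_1} ... h_{a_r} is the sum of the words that weakly increase on consecutive
    blocks of lengths a_1, ..., a_r; grouped by their sorting permutations, it is the
    signed sum of the F_{c(w)} over the shuffles w of the blocks
    ([rising_series_expansion]). Being a shuffle is a condition on the relative order
    of i and i+1 in w. Row insertion does not change that order, so the condition can
    be read on P(w), and h_a is the sum of sigma_T over those T in which i+1 is weakly
    above i whenever i and i+1 lie in the same block ([prod_complete_varsigma]).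

    These equations can be solved for the sigma_T. Encode T by its row word y, where y_i
    is the row of the entry i. If a is the shape of T and z is the sorted word with
    the letters of y, the tableaux that contribute to h_a have row words bounded by z
    letter by letter ([lattice_word_le_sorted]). So z itself, the row word of the
    superstandard tableau, contributes once, and all others have a smaller letter sum:
    induction on that sum shows that sigma_T is in OSym when T is superstandard.

    It remains to see that sigma_T depends, up to sign, only on the shape of T. An
    elementary dual equivalence exchanges two consecutive values i, i+1 having i-1 or
    i+2 between them. This changes the sign of w and keeps its descents, and it
    commutes with insertion ([schensted_dual]); hence it maps the permutations with
    tableau T to those with the dual equivalent tableau, and the two sums are opposite
    ([tableau_class_move]). Such exchanges connect all tableaux of a given shape
    ([lattice_words_connected]).

    The products h_a span OSym and are sums of the sigma_T, which gives surjectivity. *)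

(** * Row insertion and elementary dual equivalence *)

Lemma filter_nil (T : eqType) (p : pred T) s :
  {in s, forall z, ~~ p z} -> [seq z <- s | p z] = [::].
Proof.
by move=> sp; apply/eqP; rewrite -(negbK (_ == _)) -has_filter -all_predC; apply/allP.
Qed.

Variant row_insert_spec (x : nat) (R : seq nat) : option nat * seq nat -> Prop :=
| RowAppend of all (fun z => z <= x) R : row_insert_spec x R (None, rcons R x)
| RowBump A y B of R = A ++ y :: B & all (fun z => z <= x) A & x < y :
    row_insert_spec x R (Some y, A ++ x :: B).

Lemma row_insertP x R : row_insert_spec x R (row_insert x R).
Proof.
elim: R => [|z R IHR] /=; first exact: (@RowAppend x [::]).
case: ltnP => [xz | zx]; first exact: (@RowBump x (z :: R) [::] z R).
case: IHR => [Rx | A y B -> Ax xy].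
  by apply: (@RowAppend x (z :: R)); rewrite /= zx.
by apply: (@RowBump x _ (z :: A) y B); rewrite /= ?zx.
Qed.

Lemma row_insert_append x R :
  all (fun z => z <= x) R -> row_insert x R = (None, rcons R x).
Proof. by elim: R => //= z R IHR /andP[zx /IHR->]; rewrite ltnNge zx. Qed.

Lemma row_insert_bump A y B x :
  all (fun z => z <= x) A -> x < y -> row_insert x (A ++ y :: B) = (Some y, A ++ x :: B).
Proof.
by move=> + xy; elim: A => [_|z A IHA /= /andP[zx /IHA->]] /=; rewrite ?xy // ltnNge zx.
Qed.

Lemma row_insert_map (f : nat -> nat) x R :
  {in R, forall z, (f x < f z) = (x < z)} ->
  row_insert (f x) (map f R) =
    (omap f (row_insert x R).1, map f (row_insert x R).2).
Proof.
elim: R => //= z R IHR fR; rewrite fR ?mem_head //.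
case: ifP => //= _; rewrite IHR => [|u uR]; first by case: (row_insert x R).
by rewrite fR // inE uR orbT.
Qed.

Definition adj_swap (j x : nat) : nat :=
  if x == j then j.+1 else if x == j.+1 then j else x.

(** Haiman's elementary dual equivalence on the letters a, b = a+1, c = a+2: the orders
    bac and cab are exchanged by swapping b and c, the orders bca and acb by swapping
    a and b, and all other words are left alone. The value [Some j] stands for
    swapping j and j+1. *)
Definition dual_site (a : nat) (W : seq nat) : option nat :=
  let f := [seq z <- W | a <= z <= a.+2] in
  if (f == [:: a.+1; a; a.+2]) || (f == [:: a.+2; a; a.+1]) then Some a.+1
  else if (f == [:: a.+1; a.+2; a]) || (f == [:: a; a.+2; a.+1]) then Some a
  else None.

Definition dual_relabel (a : nat) (W : seq nat) : nat -> nat :=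
  oapp adj_swap id (dual_site a W).

(** Rows are read from the bottom one up; with this order the reading word of a tableau
    inserts back to it. *)
Definition reading (T : seq (seq nat)) : seq nat := flatten (rev T).

Lemma reading_cons r T : reading (r :: T) = reading T ++ r.
Proof. by rewrite /reading rev_cons flatten_rcons. Qed.

Lemma adj_swap_ltn j x z : ~~ ((x == j) && (z == j.+1)) -> ~~ ((x == j.+1) && (z == j)) ->
  (adj_swap j x < adj_swap j z) = (x < z).
Proof. rewrite /adj_swap; do 4![case: eqP => ?] => /=; lia. Qed.

Lemma adj_swapL j : adj_swap j j = j.+1.
Proof. by rewrite /adj_swap eqxx. Qed.

Lemma adj_swapR j : adj_swap j j.+1 = j.
Proof. by rewrite /adj_swap eqxx ifF //; lia. Qed.

Lemma adj_swapD j x : x != j -> x != j.+1 -> adj_swap j x = x.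
Proof. by rewrite /adj_swap => /negbTE-> /negbTE->. Qed.

Lemma adj_swapK j : involutive (adj_swap j).
Proof.
move=> e; have [->|e1] := eqVneq e j; first by rewrite adj_swapL adj_swapR.
have [->|e2] := eqVneq e j.+1; first by rewrite adj_swapR adj_swapL.
by rewrite !adj_swapD.
Qed.

Lemma dual_siteP a W j : dual_site a W = Some j ->
  exists x y z, [seq z <- W | a <= z <= a.+2] = [:: x; y; z] /\
   (x = j /\ z = j.+1 \/ x = j.+1 /\ z = j) /\ (y = a /\ j = a.+1 \/ y = a.+2 /\ j = a).
Proof.
rewrite /dual_site; case: ifP => [|_]; last case: ifP => // ; move=> /orP[] /eqP-> [<-].
- by exists a.+1, a, a.+2; split=> //; split; left.
- by exists a.+2, a, a.+1; split=> //; split; [right|left].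
- by exists a.+1, a.+2, a; split=> //; split; right.
- by exists a, a.+2, a.+1; split=> //; split; [left|right].
Qed.

Lemma dual_site_upper a W :
  [seq z <- W | a <= z <= a.+2] = [:: a.+1; a; a.+2] \/
  [seq z <- W | a <= z <= a.+2] = [:: a.+2; a; a.+1] -> dual_site a W = Some a.+1.
Proof. by rewrite /dual_site; case=> ->; rewrite eqxx ?orbT. Qed.

Lemma dual_site_lower a W :
  [seq z <- W | a <= z <= a.+2] = [:: a.+1; a.+2; a] \/
  [seq z <- W | a <= z <= a.+2] = [:: a; a.+2; a.+1] -> dual_site a W = Some a.
Proof.
by rewrite /dual_site; case=> ->; rewrite ifF ?ifT ?eqxx ?orbT // !eqseq_cons; lia.
Qed.

(** The third letter of the window always stands between the two letters that are swapped. *)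
Lemma dual_site_contig a W j X Y x z : dual_site a W = Some j ->
  [seq z <- W | a <= z <= a.+2] = X ++ x :: z :: Y ->
  ~ ((x == j) && (z == j.+1) \/ (x == j.+1) && (z == j)).
Proof.
case/dual_siteP => p [q [r [-> [pr qj]]]].
case: X => [[px qz _]|t [[_ qx rz _]|u X /(congr1 size)]]; [lia | lia |].
by rewrite /= size_cat /= !addnS.
Qed.

(** A bump moves x to the left of B and y to the left of A. Since A < x < y < B, it can
    only move letters of the window past each other by a Knuth move, either bca to bac
    or acb to cab. *)
Lemma bump_window a A y B x : sorted ltn (A ++ y :: B) ->
  all (fun z => z < x) A -> x < y ->
  let f := filter (fun z => a <= z <= a.+2) in
  [\/ f (A ++ y :: rcons B x) = f (y :: A ++ x :: B),
      [/\ x = a, y = a.+1, f A = [::] & exists B', B = a.+2 :: B' /\ f B' = [::]] |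
      [/\ x = a.+1, y = a.+2, f B = [::] & exists A', A = rcons A' a /\ f A' = [::]]].
Proof.
rewrite (sorted_pairwise ltn_trans) pairwise_cat => /and3P[Ay pA yB] Ax xy f.
have {}Ay z : z \in A -> z < y by move=> zA; have /allrelP/(_ z y zA (mem_head _ _)) := Ay.
move: yB; rewrite pairwise_cons => /andP[/allP yB pB].
have fnil s : (forall z, z \in s -> ~~ (a <= z <= a.+2)) -> f s = [::].
  exact: filter_nil.
have sA : sorted ltn A by rewrite (sorted_pairwise ltn_trans).
have sB : sorted ltn B by rewrite (sorted_pairwise ltn_trans).
move/allP in Ax.
have catE : f (A ++ y :: rcons B x) = f A ++ f [:: y] ++ f B ++ f [:: x].
  by rewrite -cats1 /f filter_cat /= filter_cat /=; case: ifP; case: ifP.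
have catE' : f (y :: A ++ x :: B) = f [:: y] ++ f A ++ f [:: x] ++ f B.
  by rewrite /f /= filter_cat /=; case: ifP; case: ifP.
rewrite {}catE {}catE'.
have [xw|xw] := boolP (a <= x <= a.+2); have [yw|yw] := boolP (a <= y <= a.+2); last first.
- rewrite [f [:: x]]fnil => [|z]; last by rewrite inE => /eqP->.
  rewrite [f [:: y]]fnil => [|z]; last by rewrite inE => /eqP->.
  by constructor 1; rewrite ?cats0.
- rewrite [f [:: x]]fnil => [|z]; last by rewrite inE => /eqP->.
  rewrite [f A]fnil => [|z /Ax]; last lia.
  by constructor 1; rewrite ?cats0.
- rewrite [f B]fnil => [|z /yB]; last lia.
  rewrite [f [:: y]]fnil => [|z]; last by rewrite inE => /eqP->.
  by constructor 1; rewrite ?cats0.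
have [xa|xa] := eqVneq x a.
  rewrite [f A]fnil => [|z /Ax]; last lia.
  have [ya|ya] := eqVneq y a.+1; last first.
    by constructor 1; rewrite [f B]fnil ?cats0 // => z /yB; lia.
  case: B yB sB {pB} => [|z B] yB sB; first by constructor 1; rewrite /= ?cats0.
  have [za|za] := eqVneq z a.+2.
    constructor 2; split=> //; exists B; split; first by rewrite za.
    apply: fnil => t tB; move: sB; rewrite /= (path_sortedE ltn_trans) => /andP[/allP/(_ _ tB) /=].
    lia.
  constructor 1; rewrite [f (z :: B)]fnil ?cats0 //= => t; have /(_ z (mem_head _ _)) := yB.
  rewrite inE => yz /predU1P[->|tB]; first by lia.
  by move: sB; rewrite /= (path_sortedE ltn_trans) => /andP[/allP/(_ _ tB) /=]; lia.
have xa1 : x = a.+1 by lia.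
have ya2 : y = a.+2 by lia.
rewrite [f B]fnil => [|z /yB]; last lia.
case/lastP: A Ax sA {Ay pA} => [|A z] Ax sA; first by constructor 1; rewrite /= ?cats0.
have zP t : t \in A -> t < z.
  by move=> tA; move: sA; rewrite (sorted_pairwise ltn_trans) pairwise_rcons => /andP[/allP/(_ _ tA)].
have [za|za] := eqVneq z a.
  constructor 3; split=> //; exists A; split; first by rewrite za.
  by apply: fnil => t /zP; lia.
constructor 1; rewrite [f (rcons _ _)]fnil ?cats0 //= => t.
have := Ax z; rewrite mem_rcons mem_head => /(_ isT) zx.
by rewrite mem_rcons => /predU1P[->|/zP]; lia.
Qed.

Lemma dual_relabel_far a W x z : x.+1 < z \/ z.+1 < x ->
  (dual_relabel a W x < dual_relabel a W z) = (x < z).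
Proof.
rewrite /dual_relabel; case: dual_site => //= j xz.
by apply: adj_swap_ltn; lia.
Qed.

Lemma dual_relabel_adjacent a W X Y x z :
  [seq t <- W | a <= t <= a.+2] = X ++ [seq t <- [:: x; z] | a <= t <= a.+2] ++ Y ->
  (dual_relabel a W x < dual_relabel a W z) = (x < z) /\
  (dual_relabel a W z < dual_relabel a W x) = (z < x).
Proof.
rewrite /dual_relabel; case E: dual_site => [j|] //= fW.
have ja : j = a \/ j = a.+1 by case/dual_siteP: E => ? [? [? [_ [_]]]]; lia.
suff H : ~ ((x == j) && (z == j.+1) \/ (x == j.+1) && (z == j)).
  by split; apply: adj_swap_ltn; lia.
move=> xz; have [xw zw] : a <= x <= a.+2 /\ a <= z <= a.+2 by lia.
by move: fW; rewrite /= xw zw => /(dual_site_contig E).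
Qed.

Lemma dual_relabel_out a W x : ~~ (a <= x <= a.+2) -> dual_relabel a W x = x.
Proof.
rewrite /dual_relabel; case E: dual_site => [j|] //= xw.
have ja : j = a \/ j = a.+1 by case/dual_siteP: E => ? [? [? [_ [_]]]]; lia.
by rewrite adj_swapD //; lia.
Qed.

Lemma map_dual_relabel_out a W s :
  [seq z <- s | a <= z <= a.+2] = [::] -> map (dual_relabel a W) s = s.
Proof.
move=> sw; rewrite -[RHS]map_id; apply/eq_in_map => z zs.
apply: dual_relabel_out; apply/negP => zw.
by have := mem_filter (fun z => a <= z <= a.+2) z s; rewrite sw zs zw.
Qed.

Lemma row_insert_perm x r :
  perm_eq (oapp (cons^~ [::]) [::] (row_insert x r).1 ++ (row_insert x r).2) (rcons r x).
Proof.
case: row_insertP => [_ | A y B -> _ _] //=.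
rewrite -cats1 -catA -cat1s perm_catCA perm_cat2l -(cat1s x) -(cat1s y B) -catA perm_cat2l.
by rewrite perm_catC.
Qed.

(** When the bump does not move letters of the window past each other, the relabelling is
    the same before and after, and it respects every comparison made by the insertion,
    because a letter of r that is swapped with x would be next to x in the window
    before or after the bump. When the bump performs a Knuth move on the window, the
    relabelling switches between swapping a, b and swapping b, c, and the relabelled
    insertion bumps in the cell next to the original one. *)
Lemma row_insert_dual a U V r x : sorted ltn r -> uniq (U ++ r ++ x :: V) ->
  let: (b, r1) := row_insert x r in
  let W := U ++ r ++ x :: V in
  let W1 := U ++ oapp (cons^~ [::]) [::] b ++ r1 ++ V in
  [/\ {in U, dual_relabel a W =1 dual_relabel a W1},
      {in V, dual_relabel a W =1 dual_relabel a W1} &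
      row_insert (dual_relabel a W x) (map (dual_relabel a W) r) =
        (omap (dual_relabel a W1) b, map (dual_relabel a W1) r1)].
Proof.
move=> sr uW; set W := U ++ _.
have xr : x \notin r.
  by move: uW; rewrite /W cat_uniq cat_uniq /= => /and5P[_ _ _]; rewrite negb_or => /andP[].
set f := filter (fun z => a <= z <= a.+2).
case: row_insertP => [xge | A y B rE Ax xy] W0 W1; rewrite /W0 {W0} -/W.
  have W1E : W1 = W by rewrite /W1 -cats1 /= -!catA.
  rewrite {}W1E; split=> //; rewrite [map _ (rcons _ _)]map_rcons.
  apply: row_insert_append; apply/allP => _ /mapP[z zr ->].
  have zx : z < x.
    by have := allP xge z zr; rewrite leq_eqVlt => /predU1P[zx|//]; rewrite -zx zr in xr.
  rewrite leqNgt; have [zx1|zx1] := ltnP z.+1 x.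
    by rewrite dual_relabel_far; [rewrite -leqNgt ltnW | right].
  have {zx zx1} xE : x = z.+1 by lia.
  have [r1 [r2 rE]] : exists r1 r2, r = r1 ++ z :: r2.
    by case/splitPr: zr => r1 r2; exists r1, r2.
  case: r2 rE => [|t r2] rE.
    rewrite (dual_relabel_adjacent (x := z) (z := x) (X := f (U ++ r1))
      (Y := f V) _).2; first lia.
    by rewrite -!filter_cat /W rE -!catA.
  have tx' : t != x.
    by apply: contraNneq xr => <-; rewrite rE mem_cat !inE eqxx !orbT.
  move: sr xge; rewrite rE (sorted_pairwise ltn_trans) pairwise_cat.
  case/and3P => _ _ /= /andP[/andP[zt _] _].
  by rewrite all_cat => /and3P[_ _ /andP[tx _]]; lia.
have {}Ax : all (fun z => z < x) A.
  apply/allP => z zA; rewrite ltn_neqAle (allP Ax z zA) andbT.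
  by apply: contraNneq xr => <-; rewrite rE mem_cat zA.
rewrite {}rE in sr xr W uW *.
have fcat s t : f (s ++ t) = f s ++ f t by exact: filter_cat.
have fcons z s : f (z :: s) = f [:: z] ++ f s by rewrite -fcat.
have fW : f W = f U ++ f (A ++ y :: rcons B x) ++ f V.
  by rewrite /f -!filter_cat /W -cats1 -!catA /= -!catA.
have fW1 : f W1 = f U ++ f (y :: A ++ x :: B) ++ f V.
  by rewrite /f -!filter_cat /W1 /= -!catA.
have yB : {in B, forall z, y < z}.
  move: sr; rewrite (sorted_pairwise ltn_trans) pairwise_cat pairwise_cons.
  by case/and4P => _ _ /allP.
have [E | [xa ya fA [B' [BE fB]]] | [xa ya fB [A' [AE fA]]]] := bump_window a sr Ax xy.
- rewrite -/f in E; have sE : dual_relabel a W =1 dual_relabel a W1.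
    by move=> z; rewrite /dual_relabel /dual_site -/f fW fW1 E.
  split; [by move=> z _ | by move=> z _ | ].
  rewrite row_insert_map.
    rewrite row_insert_bump //=; last by apply/allP => z /(allP Ax)/ltnW.
    by congr pair; [rewrite sE | exact: eq_map].
  move=> z; rewrite mem_cat inE => /or3P[zA | /eqP-> | /yB yz]; last first.
  + by apply: dual_relabel_far; lia.
  + have [xy1|xy1] := ltnP x.+1 y; first by apply: dual_relabel_far; left.
    have {xy1} yE : y = x.+1 by lia.
    have [fA|fB] : f A = [::] \/ f B = [::].
    * have [xa|xa] := leqP x a; [left|right].
        by apply: filter_nil => t /(allP Ax); lia.
      by apply: filter_nil => t /yB; lia.
    * rewrite (dual_relabel_adjacent (x := y) (z := x) (X := f U) (Y := f B ++ f V) _).2 //.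
      by rewrite -/f fW E (fcons y) (fcons y [:: x]) fcat (fcons x) fA -!catA.
    * rewrite (dual_relabel_adjacent (x := y) (z := x) (X := f U ++ f A) (Y := f V) _).2 //.
      by rewrite -/f fW fcat (fcons y) (fcons y [:: x]) -cats1 fcat fB -!catA.
  + have zx := allP Ax z zA.
    have [zx1|zx1] := ltnP z.+1 x; first by apply: dual_relabel_far; right.
    have {zx1} xE : x = z.+1 by lia.
    have [A1 [A2 AE]] : exists A1 A2, A = A1 ++ z :: A2.
      by case/splitPr: zA => A1 A2; exists A1, A2.
    case: A2 AE => [|t A2] AE; last first.
      move: sr Ax; rewrite AE (sorted_pairwise ltn_trans) pairwise_cat => /and3P[_ + _].
      rewrite pairwise_cat => /and3P[_ _ /= /andP[/andP[zt _] _]].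
      by rewrite all_cat => /and3P[_ _ /andP[tx _]]; lia.
    rewrite (dual_relabel_adjacent (x := z) (z := x) (X := f U ++ f (y :: A1))
      (Y := f B ++ f V) _).2 //.
    by rewrite -/f fW E AE (fcons y) (fcons y A1) !fcat (fcons z [:: x]) (fcons x) -!catA.
all: rewrite -/f in fA fB.
all: have abc : {subset [:: a; a.+1; a.+2] <= rcons (A ++ y :: B) x}
  by move=> z; rewrite -cats1 mem_cat mem_cat xa ya ?BE ?AE !inE ?mem_rcons ?inE; lia.
all: have fnil Z : (forall z, z \in Z -> z \notin rcons (A ++ y :: B) x) -> f Z = [::]
  by move=> ZW; apply: filter_nil => z /ZW zr; apply: contra zr => zw; apply: abc;
     rewrite !inE; move: zw => /=; lia.
all: move: (uW); rewrite -cat_rcons uniq_catCA cat_uniq => /and3P[_ /hasPn UV _].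
all: have fU : f U = [::] by apply: fnil => z zU; apply: UV; rewrite mem_cat zU.
all: have fV : f V = [::] by apply: fnil => z zV; apply: UV; rewrite mem_cat zV orbT.
all: have out z : z \in U ++ V -> dual_relabel a W z = dual_relabel a W1 z
  by move=> /UV zr; rewrite !dual_relabel_out //; apply: contra zr => zw; apply: abc;
     rewrite !inE; move: zw => /=; lia.
all: have fin z : a <= z <= a.+2 -> f [:: z] = [:: z] by rewrite /f /= => ->.
all: split; [by move=> z zU; apply: out; rewrite mem_cat zU
            |by move=> z zV; apply: out; rewrite mem_cat zV orbT|].
(* The bump turns bca into bac: x = a, y = b and B starts with c. *)
- have sW : dual_site a W = Some a.
    apply: dual_site_lower; left; rewrite -/f fW fU fV cats0 xa ya BE -cats1 !fcat fA.
    by rewrite (fcons a.+1) fcat (fcons a.+2 B') fB !fin //=; lia.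
  have sW1 : dual_site a W1 = Some a.+1.
    apply: dual_site_upper; left; rewrite -/f fW1 fU fV cats0 xa ya BE fcons fcat fA.
    by rewrite (fcons a) (fcons a.+2) fB !fin //=; lia.
  have lo : adj_swap a a.+2 = a.+2 by rewrite adj_swapD //; lia.
  have up : adj_swap a.+1 a = a by rewrite adj_swapD //; lia.
  rewrite !map_cat BE /= !map_dual_relabel_out //.
  rewrite /dual_relabel sW sW1 /= xa ya !adj_swapL !adj_swapR lo up.
  rewrite -cat_rcons row_insert_bump ?cat_rcons // all_rcons leqnSn /=.
  by apply/allP => z /(allP Ax) /=; lia.
(* The bump turns acb into cab: x = b, y = c and A ends with a. *)
- have sW : dual_site a W = Some a.
    apply: dual_site_lower; right; rewrite -/f fW fU fV cats0 xa ya AE -cats1 fcat.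
    by rewrite fcons -cats1 !fcat fA fB !fin //=; lia.
  have sW1 : dual_site a W1 = Some a.+1.
    apply: dual_site_upper; right; rewrite -/f fW1 fU fV cats0 xa ya AE fcons fcat.
    by rewrite (fcons a.+1) -cats1 fcat fA fB !fin //=; lia.
  have lo : adj_swap a a.+2 = a.+2 by rewrite adj_swapD //; lia.
  have up : adj_swap a.+1 a = a by rewrite adj_swapD //; lia.
  rewrite AE -!cats1 !map_cat /= !map_dual_relabel_out //.
  rewrite /dual_relabel sW sW1 /= xa ya !adj_swapL !adj_swapR lo up -!catA /=.
  rewrite row_insert_bump //.
  by apply/allP => z zA'; have := allP Ax z; rewrite AE mem_rcons inE zA' orbT => /(_ isT); lia.
Qed.

Lemma tableau_insert_perm x T : perm_eq (reading (tableau_insert x T)) (rcons (reading T) x).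
Proof.
elim: T x => [|r T IHT] x //=.
have := row_insert_perm x r; case: (row_insert x r) => [[y|] r1] /=.
  rewrite !reading_cons rcons_cat -(perm_cat2l (reading T)); apply: perm_trans.
  by rewrite -cat_rcons perm_cat2r.
by rewrite !reading_cons rcons_cat perm_cat2l.
Qed.

Lemma tableau_insert_sorted x T : all (sorted ltn) T -> x \notin reading T ->
  uniq (reading T) -> all (sorted ltn) (tableau_insert x T).
Proof.
elim: T x => //= r T IHT x /andP[sr sT]; rewrite reading_cons mem_cat negb_or => /andP[xT xr].
rewrite cat_uniq => /and3P[uT /hasPn rT ur].
case: row_insertP => [rx | A y B rE Ax xy] /=.
  rewrite sT andbT; case: r sr rx xr {rT ur} => //= z r sr rx xr; rewrite rcons_path sr /=.
  have := @allP _ _ (z :: r) rx (last z r) (mem_last _ _); rewrite leq_eqVlt => /predU1P[lx|//].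
  by rewrite -lx mem_last in xr.
rewrite IHT ?andbT //; last by apply: rT; rewrite rE mem_cat mem_head orbT.
move: sr; rewrite rE !(sorted_pairwise ltn_trans) !pairwise_cat !pairwise_cons /=.
case/and4P=> /allrelP AyB -> yB ->; rewrite !andbT; apply/andP; split.
  apply/allrelP => u v uA; rewrite inE => /predU1P[->|vB].
    rewrite ltn_neqAle (allP Ax u uA) andbT.
    by apply: contraNneq xr => <-; rewrite rE mem_cat uA.
  by apply: AyB => //; rewrite inE vB orbT.
by apply/allP => v /(allP yB); apply: ltn_trans.
Qed.

(** The relabelling changes only at a row that, together with the inserted letter,
    contains the whole window; so it stays the same on the letters still to be
    inserted. *)
Lemma tableau_insert_dual a x T V : all (sorted ltn) T -> uniq (reading T ++ x :: V) ->
  let T1 := tableau_insert x T in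
  let W := reading T ++ x :: V in
  let W1 := reading T1 ++ V in
  {in V, dual_relabel a W =1 dual_relabel a W1} /\
  tableau_insert (dual_relabel a W x) (map (map (dual_relabel a W)) T) =
    map (map (dual_relabel a W1)) T1.
Proof.
elim: T x V => [|r T IHT] x V //= /andP[sr sT]; rewrite reading_cons -catA => uW.
have := row_insert_dual a sr uW; have := row_insert_perm x r.
case: (row_insert x r) => [[y|] r1] /= rp [sU sV ->] /=; set W := reading T ++ r ++ _.
  have uW1 : uniq (reading T ++ y :: r1 ++ V).
    rewrite -(perm_uniq (s1 := reading T ++ r ++ x :: V)) //.
    by rewrite perm_cat2l -cat_rcons -cat_cons perm_cat2r perm_sym.
  have [E1 E2] := IHT y (r1 ++ V) sT uW1.
  rewrite reading_cons -catA; split.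
    by move=> z zV; rewrite sV // E1 // mem_cat zV orbT.
  congr (_ :: _); first by apply/eq_in_map => z zr; rewrite E1 // mem_cat zr.
  rewrite -E2; congr tableau_insert; apply/eq_in_map => s sT'; apply/eq_in_map => z zs.
  by apply: sU; apply/flattenP; exists s; rewrite // mem_rev.
rewrite reading_cons -catA; split=> //; congr (_ :: _).
apply/eq_in_map => s sT'; apply/eq_in_map => z zs.
by apply: sU; apply/flattenP; exists s; rewrite // mem_rev.
Qed.

Lemma foldl_insert_dual a w T : all (sorted ltn) T -> uniq (reading T ++ w) ->
  let T1 := foldl (fun T x => tableau_insert x T) T w in
  let f := dual_relabel a (reading T ++ w) in
  foldl (fun T x => tableau_insert x T) (map (map f) T) (map f w) =
    map (map (dual_relabel a (reading T1))) T1.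
Proof.
elim: w T => [|x w IHw] T sT uW /=; first by rewrite cats0.
have [E1 E2] := tableau_insert_dual a sT uW; rewrite E2.
have -> : map (dual_relabel a (reading T ++ x :: w)) w =
  map (dual_relabel a (reading (tableau_insert x T) ++ w)) w by apply/eq_in_map.
apply: IHw.
  move: uW; rewrite cat_uniq /= negb_or => /and3P[uT /andP[xT _] _].
  exact: tableau_insert_sorted.
rewrite (perm_uniq (s2 := reading T ++ x :: w)) // -cat_rcons perm_cat2r.
exact: tableau_insert_perm.
Qed.

Lemma schensted_dual a w : uniq w ->
  schensted (map (dual_relabel a w) w) =
    map (map (dual_relabel a (reading (schensted w)))) (schensted w).
Proof. exact: (@foldl_insert_dual a w [::]). Qed.

(** * Insertion tableaux and their row words *)

(** As A < x < y < B, a letter moves only past letters that differ from it by at least 2. *)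
Lemma bump_pair j A y B x : sorted ltn (A ++ y :: B) ->
  all (fun z => z <= x) A -> x \notin A -> x < y ->
  [seq z <- A ++ y :: rcons B x | j <= z <= j.+1] =
  [seq z <- y :: A ++ x :: B | j <= z <= j.+1].
Proof.
move=> sr Ax xA xy; set f := filter _.
have {}Ax : {in A, forall z, z < x}.
  move=> z zA; rewrite ltn_neqAle (allP Ax z zA) andbT.
  by apply: contraNneq xA => <-.
have yB : {in B, forall z, y < z}.
  move: sr; rewrite (sorted_pairwise ltn_trans) pairwise_cat pairwise_cons.
  by case/and4P => _ _ /allP.
have fcat s t : f (s ++ t) = f s ++ f t by exact: filter_cat.
have fcons z s : f (z :: s) = f [:: z] ++ f s by rewrite -fcat.
have fnil s : {in s, forall z, ~~ (j <= z <= j.+1)} -> f s = [::] by exact: filter_nil.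
rewrite !fcat fcons -cats1 fcat (fcons y (A ++ _)) fcat (fcons x B).
have [xw|xw] := boolP (j <= x <= j.+1); have [yw|yw] := boolP (j <= y <= j.+1).
- by rewrite (fnil A) ?(fnil B) ?cats0 // => z; [move/yB | move/Ax]; lia.
- rewrite (fnil [:: y]) => [|z]; last by rewrite inE => /eqP->.
  by rewrite (fnil B) ?cats0 // => z /yB; lia.
- rewrite (fnil [:: x]) => [|z]; last by rewrite inE => /eqP->.
  by rewrite (fnil A) ?cats0 // => z /Ax; lia.
- rewrite (fnil [:: x]) => [|z]; last by rewrite inE => /eqP->.
  rewrite (fnil [:: y]) => [|z]; last by rewrite inE => /eqP->.
  by rewrite ?cats0.
Qed.

Lemma tableau_insert_pair j x T : all (sorted ltn) T -> uniq (rcons (reading T) x) ->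
  [seq z <- reading (tableau_insert x T) | j <= z <= j.+1] =
  [seq z <- rcons (reading T) x | j <= z <= j.+1].
Proof.
elim: T x => [|r T IHT] x //= /andP[sr sT]; rewrite reading_cons rcons_uniq cat_uniq mem_cat.
rewrite negb_or => /and3P[/andP[xT xr] uT /andP[/hasPn rT ur]].
case: row_insertP => [rx | A y B rE Ax xy] /=; first by rewrite reading_cons rcons_cat.
rewrite reading_cons filter_cat IHT //.
  rewrite -filter_cat cat_rcons rcons_cat filter_cat [RHS]filter_cat; congr cat.
  rewrite rE rcons_cat rcons_cons; apply/esym/bump_pair; rewrite // -?rE //.
  by apply: contra xr; rewrite rE mem_cat => ->.
by rewrite rcons_uniq uT andbT; apply: rT; rewrite rE mem_cat mem_head orbT.
Qed.

Lemma schensted_rcons w x : schensted (rcons w x) = tableau_insert x (schensted w).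
Proof. by rewrite /schensted foldl_rcons. Qed.

Lemma schensted_perm w : perm_eq (reading (schensted w)) w.
Proof.
elim/last_ind: w => // w x IHw; rewrite schensted_rcons.
by apply: (perm_trans (tableau_insert_perm x _)); rewrite -!cats1 perm_cat2r.
Qed.

Lemma schensted_sorted w : uniq w -> all (sorted ltn) (schensted w).
Proof.
elim/last_ind: w => // w x IHw; rewrite rcons_uniq schensted_rcons => /andP[xw uw].
apply: tableau_insert_sorted; first exact: IHw.
  by rewrite (perm_mem (schensted_perm w)).
by rewrite (perm_uniq (schensted_perm w)).
Qed.

(** So the relative order of j and j+1 in w is determined by the insertion tableau. *)
Lemma schensted_pair j w : uniq w ->
  [seq z <- reading (schensted w) | j <= z <= j.+1] = [seq z <- w | j <= z <= j.+1].
Proof.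
elim/last_ind: w => // w x IHw; rewrite rcons_uniq schensted_rcons => /andP[xw uw].
rewrite tableau_insert_pair ?schensted_sorted //; first by rewrite !filter_rcons IHw.
by rewrite rcons_uniq (perm_mem (schensted_perm w)) xw (perm_uniq (schensted_perm w)).
Qed.

Definition col_strict (r r' : seq nat) : bool :=
  (size r' <= size r) && all (fun p => p.1 < p.2) (zip r r').

Lemma col_strictP r r' :
  reflect (size r' <= size r /\ forall c, c < size r' -> nth 0 r c < nth 0 r' c) (col_strict r r').
Proof.
apply: (iffP andP) => -[sz H]; split=> //.
  move=> c cr; have /(all_nthP (0, 0))/(_ c) := H.
  by rewrite size_zip (minn_idPr sz) nth_zip_cond size_zip (minn_idPr sz) cr; exact.
apply/(all_nthP (0, 0)) => c; rewrite size_zip (minn_idPr sz) => cr.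
by rewrite nth_zip_cond size_zip (minn_idPr sz) cr; apply: H.
Qed.

Lemma nth_cat_cons A (y : nat) B c :
  nth 0 (A ++ y :: B) c = if c < size A then nth 0 A c else
     if c == size A then y else nth 0 B (c - size A).-1.
Proof.
rewrite nth_cat; case: ltnP => // ; rewrite leq_eqVlt eq_sym => /predU1P[->|Ac].
  by rewrite eqxx subnn.
by rewrite gtn_eqF //; case: (c - size A) (subn_gt0 (size A) c) => //; rewrite Ac.
Qed.

(** The letter y leaves the column size A and enters the next row weakly to the left of
    that column, where the row above has letters at most x < y. *)
Lemma bump_col_strict x y A B r2 : sorted ltn (A ++ y :: B) -> all (fun z => z <= x) A ->
  x < y -> col_strict (A ++ y :: B) r2 -> col_strict (A ++ x :: B) (row_insert y r2).2.
Proof.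
move=> sr Ax xy /col_strictP[sz H]; apply/col_strictP.
have le1 c : nth 0 (A ++ x :: B) c <= nth 0 (A ++ y :: B) c.
  by rewrite !nth_cat_cons; case: ifP => // _; case: ifP => // _; apply: ltnW.
have lex c : c <= size A -> nth 0 (A ++ x :: B) c <= x.
  rewrite nth_cat_cons; case: ltnP => [cA _|Ac cA]; first exact: (allP Ax) (mem_nth _ _).
  by rewrite eqn_leq cA Ac.
have szE : size (A ++ x :: B) = size (A ++ y :: B) by rewrite !size_cat.
have yA : nth 0 (A ++ y :: B) (size A) = y by rewrite nth_cat_cons ltnn eqxx.
have le_size s : all (fun z => z <= y) s -> (forall c, c < size s -> nth 0 s c = nth 0 r2 c) ->
   size s <= size r2 -> size s <= size A.
  move=> sy sE sr2; rewrite leqNgt; apply/negP => As.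
  have := H _ (leq_trans As sr2); rewrite yA -sE // ltnNge.
  by rewrite (allP sy) ?mem_nth.
case: row_insertP => [r2y | A2 y2 B2 r2E A2y yy2] /=.
  have r2A : size r2 <= size A by apply: le_size.
  split; first by rewrite size_rcons szE size_cat /= addnS ltnS (leq_trans r2A) ?leq_addr.
  move=> c; rewrite size_rcons ltnS leq_eqVlt nth_rcons => /predU1P[->|cr].
    by rewrite ltnn eqxx (leq_ltn_trans _ xy) // lex.
  by rewrite cr (leq_ltn_trans (le1 c)) // H.
have A2A : size A2 <= size A.
  apply: le_size => //; last by rewrite r2E size_cat leq_addr.
  by move=> c cA; rewrite r2E nth_cat cA.
rewrite szE; split; first by rewrite (leq_trans _ sz) // r2E !size_cat.
move=> c cr; have [->|cA] := eqVneq c (size A2).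
  by rewrite (nth_cat_cons A2) ltnn eqxx (leq_ltn_trans (lex _ A2A)).
have cr2 : c < size r2 by move: cr; rewrite r2E !size_cat.
have := H c cr2; rewrite r2E !(nth_cat_cons A2) (negbTE cA).
exact: leq_ltn_trans (le1 c).
Qed.

Lemma tableau_insert_cols x T : all (fun r => 0 < size r) T -> all (sorted ltn) T ->
  sorted col_strict T ->
  all (fun r => 0 < size r) (tableau_insert x T) /\ sorted col_strict (tableau_insert x T).
Proof.
elim: T x => [|r T IHT] x //= /andP[r0 T0] /andP[sr sT] cT.
have {}IHT y := IHT y T0 sT (path_sorted cT).
case: row_insertP => [rx | A y B rE Ax xy] /=.
  split; first by rewrite size_rcons.
  case: T cT {IHT sT T0} => //= r2 T /andP[/col_strictP[sz H] ->]; rewrite andbT.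
  apply/col_strictP; split; first by rewrite size_rcons ltnW.
  by move=> c cr; rewrite nth_rcons (leq_trans cr sz) H.
have [IH1 IH2] := IHT y; split; first by rewrite IH1 size_cat addnS.
case: T cT {IHT sT T0} IH1 IH2 => [|r2 T] /=.
  move=> _ _ _; rewrite andbT; apply/col_strictP; split; first by rewrite size_cat addnS.
  case=> // _; rewrite nth_cat_cons /=; case: A Ax {rE} => //= z A /andP[zx _].
  exact: leq_ltn_trans xy.
rewrite rE in sr *; case/andP=> cr _ _; have := bump_col_strict sr Ax xy cr.
by case: (row_insert y r2) => b2 r2' /= -> ->.
Qed.

Lemma schensted_cols w : uniq w ->
  all (fun r => 0 < size r) (schensted w) /\ sorted col_strict (schensted w).
Proof.
elim/last_ind: w => // w x IHw; rewrite rcons_uniq schensted_rcons => /andP[xw uw].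
by have [h1 h2] := IHw uw; apply: tableau_insert_cols => //; apply: schensted_sorted.
Qed.

Lemma reading_flatten T : perm_eq (reading T) (flatten T).
Proof. by apply: perm_flatten; rewrite perm_rev. Qed.

Lemma schensted_syt n w : perm_eq w (iota 1 n) -> is_syt (schensted w).
Proof.
move=> wn; have uw : uniq w by rewrite (perm_uniq wn) iota_uniq.
have Pw : perm_eq (flatten (schensted w)) w.
  by rewrite -(permPl (reading_flatten _)) schensted_perm.
have [h1 h2] := schensted_cols uw.
rewrite /is_syt h1 schensted_sorted // (perm_size Pw) (perm_size wn) size_iota.
by rewrite (perm_trans Pw wn).
Qed.

Definition row_of (T : seq (seq nat)) (e : nat) : nat := find (fun r => e \in r) T.

(** In this encoding, swapping two entries of T becomes swapping two letters, and the
    standard tableaux of a given shape become the lattice words of a given content. *)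
Definition row_word (T : seq (seq nat)) : seq nat :=
  [seq row_of T e | e <- iota 1 (size (flatten T))].

Definition tableau_of (y : seq nat) : seq (seq nat) :=
  [seq [seq e <- iota 1 (size y) | nth 0 y e.-1 == r] | r <- iota 0 (\max_(i <- y) i.+1)].

(** Yamanouchi words: every prefix has the content of a partition. *)
Definition lattice_word (y : seq nat) : Prop :=
  forall m i, count_mem i.+1 (take m y) <= count_mem i (take m y).

Lemma row_ofP T e r : uniq (flatten T) -> e \in flatten T ->
  (row_of T e == r) = (e \in nth [::] T r).
Proof.
elim: T r => //= s T IHT r; rewrite cat_uniq mem_cat => /and3P[us /hasPn sT uT].
rewrite /row_of /=; case: ifP => [es _ | es /= eT].
  case: r => [|r]; first by rewrite es.
  symmetry; apply/negbTE/negP => /= er; have [rT|rT] := ltnP r (size T); last first.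
    by rewrite nth_default in er.
  suff /sT : e \in flatten T by rewrite es.
  by apply/flattenP; exists (nth [::] T r); rewrite ?mem_nth.
by case: r => [|r]; rewrite /= ?es // eqSS; apply: IHT.
Qed.

Lemma row_of_lt T e : (row_of T e < size T) = (e \in flatten T).
Proof.
rewrite -has_find; apply/hasP/flattenP => [[s]|[s]]; by exists s.
Qed.

Lemma size_row_word T : size (row_word T) = size (flatten T).
Proof. by rewrite size_map size_iota. Qed.

Lemma nth_row_word T e : 0 < e <= size (flatten T) -> nth 0 (row_word T) e.-1 = row_of T e.
Proof.
move=> eT; have en : e.-1 < size (flatten T) by lia.
by rewrite (nth_map 0) ?size_iota // nth_iota // add1n prednK //; lia.
Qed.

Lemma syt_flatten T : is_syt T -> uniq (flatten T) /\ flatten T =i iota 1 (size (flatten T)).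
Proof.
case/and4P => Tp _ _ _; split; last exact: perm_mem.
by rewrite (perm_uniq Tp) iota_uniq.
Qed.

Lemma syt_tableau_of T : is_syt T -> T = tableau_of (row_word T).
Proof.
move=> sT; have [uT mT] := syt_flatten sT; case/and4P: sT => Tp T0 Ts _.
have -> : tableau_of (row_word T) = [seq nth [::] T r | r <- iota 0 (size T)].
  rewrite /tableau_of; have -> : \max_(i <- row_word T) i.+1 = size T.
    apply/eqP; rewrite eqn_leq; apply/andP; split.
      rewrite big_tnth; apply/bigmax_leqP => i _; have := mem_tnth i (in_tuple (row_word T)).
      by case/mapP => e; rewrite -mT => eT ->; rewrite row_of_lt.
    case/lastP: T {Ts} T0 uT mT Tp => // T r; rewrite all_rcons => /andP[r0 _] uT mT _.
    have hr : head 0 r \in nth [::] (rcons T r) (size T).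
      by rewrite nth_rcons ltnn eqxx; case: r r0 {uT mT} => //= *; apply: mem_head.
    have hT : head 0 r \in flatten (rcons T r).
      by apply/flattenP; exists r; [rewrite mem_rcons mem_head | rewrite nth_rcons ltnn eqxx in hr].
    rewrite size_rcons; have := hr; rewrite -row_ofP // => /eqP <-.
    apply: (@leq_bigmax_seq _ _ predT succn) => //.
    by apply/mapP; exists (head 0 r); rewrite // -mT.
  apply/eq_in_map => r; rewrite mem_iota add0n => /= rT.
  apply: (@irr_sorted_eq _ ltn ltn_trans ltnn).
  - by apply: sorted_filter ltn_trans _ _ (iota_ltn_sorted _ _).
  - by apply: (allP Ts); apply: mem_nth.
  move=> e; rewrite mem_filter size_row_word.
  have [eT|eT] := boolP (e \in iota 1 (size (flatten T))).
    by rewrite nth_row_word ?andbT ?row_ofP ?mT //; move: eT; rewrite mem_iota; lia.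
  rewrite andbF; symmetry; apply/negbTE; apply: contra eT => er.
  by rewrite -mT; apply/flattenP; exists (nth [::] T r); rewrite ?mem_nth.
by rewrite -/(mkseq _ _) mkseq_nth.
Qed.

(** Since columns increase, among the entries up to m a row has at most as many as the row
    above. *)
Lemma syt_lattice_word T : is_syt T -> lattice_word (row_word T).
Proof.
move=> sT; have [uT mT] := syt_flatten sT; case/and4P: sT => Tp T0 Ts Tc.
have cntE m i : count_mem i (take m (row_word T)) = count (fun e => e <= m) (nth [::] T i).
  rewrite /row_word -map_take take_iota count_map -!size_filter; apply: perm_size.
  apply: uniq_perm; rewrite ?filter_uniq ?iota_uniq //.
    have [iT|iT] := ltnP i (size T); last by rewrite nth_default.
    by apply: (sorted_uniq ltn_trans ltnn); apply: (allP Ts); apply: mem_nth.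
  move=> e; rewrite !mem_filter /= mem_iota.
  have [eT|eT] := boolP (e \in flatten T).
    rewrite row_ofP //; move: eT; rewrite mT mem_iota => eT; rewrite andbC; congr andb.
    by lia.
  have -> : (0 < e) && (e < 1 + minn m (size (flatten T))) = false.
    by apply: contraNF eT; rewrite mT mem_iota; lia.
  rewrite andbF; symmetry; apply/negbTE; apply: contra eT => /andP[_ ei].
  have [iT|iT] := ltnP i (size T); last by rewrite nth_default in ei.
  by apply/flattenP; exists (nth [::] T i); rewrite ?mem_nth.
move=> m i; rewrite !cntE.
have [iT|iT] := ltnP i.+1 (size T); last by rewrite (nth_default _ iT).
have /(sortedP [::])/(_ i iT) := Tc; rewrite -/(col_strict _ _).
elim: (nth _ T i) (nth _ T i.+1) => [|a r IHr] [|b r'] //=.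
rewrite /col_strict /= ltnS => /andP[sz /andP[ab H]]; apply: leq_add.
  by case: (leqP b m) => // bm; rewrite (ltnW (leq_trans ab bm)).
by apply: IHr; rewrite /col_strict sz.
Qed.

(** * Reading words of tableaux given by row words *)

Definition reading_order (y : seq nat) (e f : nat) : bool :=
  (nth 0 y f.-1 < nth 0 y e.-1) || (nth 0 y e.-1 == nth 0 y f.-1) && (e < f).

Lemma reading_order_trans y : transitive (reading_order y).
Proof. by move=> f e g; rewrite /reading_order; lia. Qed.

Lemma reading_order_irr y : irreflexive (reading_order y).
Proof. by move=> e; rewrite /reading_order !ltnn andbF. Qed.

Lemma nth_lt_bigmax y e : e \in iota 1 (size y) -> nth 0 y e.-1 < \max_(i <- y) i.+1.
Proof.
rewrite mem_iota => ey; have en : e.-1 < size y by lia.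
by apply: (@leq_bigmax_seq _ _ predT succn) => //; apply: mem_nth.
Qed.

Lemma mem_reading_tableau_of y : reading (tableau_of y) =i iota 1 (size y).
Proof.
move=> e; rewrite (perm_mem (reading_flatten _)); apply/flattenP/idP.
  by case=> _ /mapP[r _ ->]; rewrite mem_filter => /andP[].
move=> ey; exists [seq e' <- iota 1 (size y) | nth 0 y e'.-1 == nth 0 y e.-1].
  by apply/mapP; exists (nth 0 y e.-1); rewrite // mem_iota add0n nth_lt_bigmax.
by rewrite mem_filter eqxx.
Qed.

Lemma reading_tableau_of_sorted y : sorted (reading_order y) (reading (tableau_of y)).
Proof.
rewrite /reading /tableau_of -map_rev; set n := \max_(_ <- _) _.
suff : pairwise (reading_order y) (flatten [seq [seq e <- iota 1 (size y) | nth 0 y e.-1 == r]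
   | r <- rev (iota 0 n)]).
  by move/pairwise_sorted.
elim: n => // n IHn.
have -> : iota 0 n.+1 = iota 0 n ++ [:: n] by rewrite -(addn1 n) iotaD.
rewrite rev_cat /= pairwise_cat IHn andbT.
apply/andP; split.
  apply/allrelP => e f; rewrite mem_filter => /andP[/eqP er _] /flattenP[_ /mapP[r + ->]].
  rewrite mem_rev mem_iota mem_filter => /andP[_ rn] /andP[/eqP fr _].
  by rewrite /reading_order er fr rn.
rewrite -(sorted_pairwise (@reading_order_trans y)).
have : sorted ltn [seq e <- iota 1 (size y) | nth 0 y e.-1 == n].
  by apply: sorted_filter ltn_trans _ _ (iota_ltn_sorted _ _).
apply: (sub_in_sorted (P := fun e => nth 0 y e.-1 == n)); last exact: filter_all.
by move=> e f /eqP er /eqP fr; rewrite /reading_order er fr eqxx ltnn.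
Qed.

(** The reading word is sorted for [reading_order], so its restriction to a set of entries
    is obtained by sorting them. *)
Lemma filter_reading_tableau_of y (p : pred nat) L : sorted (reading_order y) L ->
  (forall e, (e \in L) = p e && (0 < e <= size y)) ->
  [seq e <- reading (tableau_of y) | p e] = L.
Proof.
move=> sL mL; apply: (irr_sorted_eq (@reading_order_trans y) (@reading_order_irr y)) => //.
  by apply: sorted_filter (@reading_order_trans y) _ _ (reading_tableau_of_sorted y).
by move=> e; rewrite mem_filter mL mem_reading_tableau_of mem_iota; congr andb; lia.
Qed.

(** Consecutive entries of different rows can trade places without disturbing any row. *)
Lemma tableau_of_swap p u v t q : v != t ->
  map (map (adj_swap (size p).+2)) (tableau_of (p ++ [:: u; v; t] ++ q)) =
  tableau_of (p ++ [:: u; t; v] ++ q).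
Proof.
move=> vt; set y := p ++ _; set y' := p ++ _; set j := (size p).+2.
have nthE e : 0 < e -> nth 0 y' e.-1 = nth 0 y (adj_swap j e).-1.
  have nthp i s : nth 0 (p ++ s) (size p + i) = nth 0 s i.
    by rewrite nth_cat ltnNge leq_addr addKn.
  move=> e0; have [ep|pe] := ltnP e.-1 (size p).
    by rewrite /y /y' /adj_swap !ifF ?nth_cat ?ep // /j; lia.
  have -> : e = (size p + (e.-1 - size p)).+1 by lia.
  case: (e.-1 - size p) => [|[|[|i]]].
  - have -> : adj_swap j (size p + 0).+1 = (size p + 0).+1 by rewrite adj_swapD // /j; lia.
    by rewrite /= !nthp.
  - have -> : adj_swap j (size p + 1).+1 = (size p + 2).+1 by rewrite /adj_swap ifT /j; lia.
    by rewrite /= !nthp.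
  - have -> : adj_swap j (size p + 2).+1 = (size p + 1).+1.
      by rewrite /adj_swap ifF ?ifT /j; lia.
    by rewrite /= !nthp.
  - have -> : adj_swap j (size p + i.+3).+1 = (size p + i.+3).+1.
      by rewrite adj_swapD // /j; lia.
    by rewrite /= !nthp.
have szE : size y' = size y by rewrite !size_cat.
have swap_iota e : (adj_swap j e \in iota 1 (size y)) = (e \in iota 1 (size y)).
  rewrite !mem_iota /adj_swap /y !size_cat /= /j.
  have [->|ej] := eqVneq e (size p).+2 => /=; first by lia.
  by have [->|ej1] := eqVneq e (size p).+3 => /=; lia.
have swapK := adj_swapK j.
rewrite /tableau_of -map_comp szE.
have -> : \max_(i <- y') i.+1 = \max_(i <- y) i.+1.
  apply: perm_big; rewrite /y /y' perm_cat2l /= perm_cons.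
  exact: permEl (perm_catCA [:: t] [:: v] q).
apply: eq_map => r /=; apply: (@irr_sorted_eq _ ltn ltn_trans ltnn).
- have : sorted ltn [seq e <- iota 1 (size y) | nth 0 y e.-1 == r].
    by apply: sorted_filter ltn_trans _ _ (iota_ltn_sorted _ _).
  apply: (homo_sorted_in (P := fun e => nth 0 y e.-1 == r)); last exact: filter_all.
  move=> e f /eqP er /eqP fr /= ef; rewrite /= adj_swap_ltn //; last by move: ef; lia.
  apply/negP => /andP[/eqP ej /eqP fj]; move: er fr vt; rewrite ej fj /y /j /=.
  rewrite -(addn2 (size p)) -(addn1 (size p)) !nth_cat !ltnNge !leq_addr !addKn /=.
  by move=> -> ->; rewrite eqxx.
- by apply: sorted_filter ltn_trans _ _ (iota_ltn_sorted _ _).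
move=> e; rewrite -{1}(swapK e) mem_map; last exact: inv_inj.
rewrite !mem_filter swap_iota; have [ei|] := boolP (e \in iota _ _); last by rewrite !andbF.
by rewrite nthE //; move: ei; rewrite mem_iota => /andP[].
Qed.

(** * Connectedness of the lattice words of a given content *)

Definition partition_content (y : seq nat) : Prop :=
  forall i, count_mem i.+1 y <= count_mem i y.

Lemma lattice_word_partition y : lattice_word y -> partition_content y.
Proof. by move=> ly i; have := ly (size y) i; rewrite take_size. Qed.

Lemma lattice_word_rcons y x : lattice_word y -> partition_content (rcons y x) -> lattice_word (rcons y x).
Proof.
move=> ly py m i; have [my|my] := leqP m (size y); first by rewrite -cats1 takel_cat.
by rewrite take_oversize ?size_rcons.
Qed.

Lemma lattice_word_belast y x : lattice_word (rcons y x) -> lattice_word y.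
Proof.
move=> ly m i; have [my|my] := leqP m (size y).
  by have := ly m i; rewrite -cats1 takel_cat.
by have := ly (size y) i; rewrite -cats1 takel_cat // take_size take_oversize // ltnW.
Qed.

(** In a sorted word, all letters i come before the first letter i+1. *)
Lemma sorted_lattice_word y : sorted leq y -> partition_content y -> lattice_word y.
Proof.
move=> sy py m i; have [i1|] := boolP (i.+1 \in take m y); last first.
  by rewrite -has_pred1 has_count -leqNgt leqn0 => /eqP->.
have [id|] := boolP (i \in drop m y).
  move: sy; rewrite -{1}(cat_take_drop m y) (sorted_pairwise leq_trans) pairwise_cat.
  by case/and3P => /allrelP/(_ _ _ i1 id); rewrite ltnn.
rewrite -has_pred1 has_count -leqNgt leqn0 => /eqP c0.
have := py i; rewrite -{1 2}(cat_take_drop m y) !count_cat c0 addn0.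
by apply: leq_trans; rewrite leq_addr.
Qed.

Lemma partition_perm y z : perm_eq y z -> partition_content y -> partition_content z.
Proof. by move=> /seq.permP yz py i; rewrite -!yz. Qed.

(** Induction on the length. Let r be the largest letter of the word. If the last letter
    is r, sort the other letters. If it is r' < r, use the induction hypothesis to
    bring the other letters into the form nu, r-1, r with nu sorted; the assumption
    exchanges r with r', and then r is last. *)
Lemma lattice_words_connected (O : seq nat -> Prop) :
  (forall p u v t q, t <= u < v -> O (p ++ [:: u; v; t] ++ q) <-> O (p ++ [:: u; t; v] ++ q)) ->
  forall y, lattice_word y -> forall q, O (y ++ q) <-> O (sort leq y ++ q).
Proof.
move=> Omove y; have [n] := ubnP (size y); elim: n y => // n IHn y.
case/lastP: y => [|y r'] // yn ly q; rewrite size_rcons ltnS in yn.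
have sortE s w x : perm_eq (rcons s x) w -> all (fun z => z <= x) w ->
    sort leq w = rcons (sort leq s) x.
  move=> sw wx; apply: (sorted_eq leq_trans anti_leq); first exact: sort_sorted leq_total _.
    rewrite (sorted_pairwise leq_trans) pairwise_rcons -(sorted_pairwise leq_trans).
    rewrite sort_sorted ?andbT; last exact: leq_total.
    apply/allP => z; rewrite mem_sort => zs; apply: (allP wx).
    by rewrite -(perm_mem sw) mem_rcons inE zs orbT.
  rewrite (permPl (permEl (perm_sort _ _))) -(permPl sw) -!cats1 perm_cat2r perm_sym.
  exact: permEl (perm_sort _ _).
have ly0 := lattice_word_belast ly; have py := lattice_word_partition ly; have py0 := lattice_word_partition ly0.
have [r ry ler] : exists2 r, r \in rcons y r' & all (fun z => z <= r) (rcons y r').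
  have sz : 0 < size (sort leq (rcons y r')) by rewrite size_sort size_rcons.
  have : sorted leq (sort leq (rcons y r')) by apply: sort_sorted leq_total _.
  case/lastP E : (sort leq (rcons y r')) sz => [|s r] // _ ss; exists r.
    by rewrite -(mem_sort leq) E mem_rcons mem_head.
  apply/allP => z; rewrite -(mem_sort leq) E mem_rcons inE => /predU1P[->//|zs].
  move: ss; rewrite (sorted_pairwise leq_trans) pairwise_rcons => /andP[/allP H _].
  exact: H.
have [rr'|rr'] := eqVneq r' r.
  by rewrite rr' in ler *; rewrite (sortE y _ r) // !cat_rcons; apply: IHn.
have r'r : r' < r by rewrite ltn_neqAle rr' (allP ler) // mem_rcons mem_head.
have ry0 : r \in y by move: ry; rewrite mem_rcons inE eq_sym (negbTE rr').
have cr0 : 0 < count_mem r y by rewrite -has_count has_pred1.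
have crS i : r < i -> count_mem i y = 0.
  move=> ri; apply/eqP; rewrite -leqn0 leqNgt -has_count has_pred1; apply/negP => iy.
  by have := allP ler i; rewrite mem_rcons inE iy orbT => /(_ isT); rewrite leqNgt ri.
have [a aE] : exists a, r = a.+1 by exists r.-1; lia.
have ay : 0 < count_mem a y by apply: leq_trans (py0 a); rewrite -aE.
have ar : a \in rem r y.
  by rewrite -has_pred1 has_count count_mem_rem; rewrite [r == a]gtn_eqF ?subn0 // aE.
pose nu := sort leq (rem a (rem r y)).
have nuE : perm_eq (rcons (rcons nu a) r) y.
  rewrite -!cats1 perm_sym (permPl (perm_to_rem ry0)) -cat1s perm_catC perm_cat2r.
  rewrite (permPl (perm_to_rem ar)) -cat1s perm_catC perm_cat2r perm_sym.
  exact: permEl (perm_sort _ _).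
have cnu i : count_mem i y = count_mem i nu + (a == i) + (r == i).
  by rewrite -(seq.permP nuE) -!cats1 !count_cat /= !addn0.
have pyc i : count_mem i.+1 y + (r' == i.+1) <= count_mem i y + (r' == i).
  by have := py i; rewrite -cats1 !count_cat /= !addn0.
have lnu : lattice_word nu.
  apply: sorted_lattice_word; first exact: sort_sorted leq_total _.
  by move=> i; have := py0 i; have := crS i.+1; rewrite !cnu; lia.
have lnua : lattice_word (rcons nu a).
  apply: lattice_word_rcons => // i; have := py0 i; have := crS i.+1.
  by rewrite !cnu -!cats1 !count_cat /= !addn0; lia.
have lz : lattice_word (rcons (rcons nu a) r).
  by apply: lattice_word_rcons => //; apply: partition_perm py0; rewrite perm_sym.
have lz' : lattice_word (rcons (rcons nu a) r').
  apply: lattice_word_rcons => // i; have := pyc i; have := crS i.+1.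
  by rewrite !cnu -!cats1 !count_cat /= !addn0; lia.
have sz : size y = (size nu).+2 by rewrite -(perm_size nuE) !size_rcons.
have sortz : sort leq (rcons (rcons nu a) r) = sort leq y.
  by apply/(perm_sortP leq_total leq_trans anti_leq).
have sorty : sort leq (rcons y r') = rcons (sort leq (rcons (rcons nu a) r')) r.
  apply: sortE => //; apply/seq.permP => p.
  by rewrite -!cats1 !count_cat -(seq.permP nuE) -!cats1 !count_cat addnAC.
rewrite cat_rcons; apply: iff_trans (IHn y yn ly0 _) _; rewrite -sortz.
apply: iff_trans (iff_sym (IHn _ _ lz _)) _; first by rewrite !size_rcons -sz.
rewrite !cat_rcons; apply: iff_trans (Omove nu a r r' q _) _; first by lia.
rewrite sorty cat_rcons; have := IHn (rcons (rcons nu a) r') _ lz' (r :: q).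
by rewrite !cat_rcons; apply; rewrite !size_rcons -sz.
Qed.

(** An entry in row r+1 lies below a smaller one in row r. *)
Lemma lattice_word_pred y i r : lattice_word y -> i < size y -> nth 0 y i = r.+1 ->
  exists2 j, j < i & nth 0 y j = r.
Proof.
move=> ly iy yi; have : r \in take i.+1 y.
  rewrite -has_pred1 has_count; apply: leq_trans (ly i.+1 r); rewrite -has_count has_pred1.
  by rewrite (take_nth 0) // mem_rcons yi mem_head.
rewrite (take_nth 0) // mem_rcons inE yi => /predU1P[/eqP|]; first by lia.
by move=> /(nthP 0)[j]; rewrite size_take iy => ji; rewrite nth_take // => yj; exists j.
Qed.

(** Inside a block of equal letters of z, the letters of y weakly decrease. At a new block
    z grows by at least 1, and a letter of y exceeds the maximum of the earlier ones
    by at most 1. *)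
Lemma lattice_word_le_sorted y z : lattice_word y -> sorted leq z -> size y = size z ->
  (forall i, i.+1 < size z -> nth 0 z i = nth 0 z i.+1 -> nth 0 y i.+1 <= nth 0 y i) ->
  forall i, i < size z -> nth 0 y i <= nth 0 z i.
Proof.
move=> ly sz yz H i; elim/ltn_ind: i => -[|i] IHi iz.
  case E : (nth 0 y 0) => [|r] //.
  by have [|j] := lattice_word_pred ly _ E; rewrite ?yz.
have := sorted_leq_nth leq_trans leqnn 0 sz; rewrite /prop_in2 /= => mono.
have [zE|zE] := eqVneq (nth 0 z i) (nth 0 z i.+1).
  by apply: leq_trans (H i iz zE) _; rewrite -zE IHi // ltnW.
have zlt : nth 0 z i < nth 0 z i.+1.
  by rewrite ltn_neqAle zE mono // inE // ltnW.
case E : (nth 0 y i.+1) => [|r] //.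
have [|j] := lattice_word_pred ly _ E; rewrite ?yz // ltnS => ji <-.
apply: leq_ltn_trans zlt; have jz : j < size z by apply: leq_ltn_trans ji (ltnW iz).
by apply: leq_trans (IHi j _ jz) _; rewrite ?ltnS // mono // inE // ltnW.
Qed.

Lemma sumn_lt_nth y z : size y = size z ->
  (forall i, i < size z -> nth 0 y i <= nth 0 z i) -> y = z \/ sumn y < sumn z.
Proof.
elim: y z => [|a y IHy] [|b z] //=; [by left|].
move=> [yz] H; have /= ab := H 0 (ltn0Sn _).
have [i iz|->|lt] := IHy z yz; first exact: (H i.+1).
  by move: ab; rewrite leq_eqVlt => /predU1P[->|ab]; [left|right; rewrite ltn_add2r].
by right; lia.
Qed.

(** * Signs, and dual equivalence on permutations *)

Lemma size_perm_word n (s : 'S_n) : size (perm_word s) = n.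
Proof. by rewrite size_map size_enum_ord. Qed.

Lemma nth_perm_word n (s : 'S_n) (i : 'I_n) : nth 0 (perm_word s) i = (s i).+1.
Proof. by rewrite (nth_map i) ?nth_ord_enum ?size_enum_ord. Qed.

Lemma perm_word_perm n (s : 'S_n) : perm_eq (perm_word s) (iota 1 n).
Proof.
apply: uniq_perm; rewrite ?iota_uniq //.
  rewrite map_inj_uniq ?enum_uniq // => i j [sij].
  by apply: (@perm_inj _ s); apply: val_inj.
move=> e; rewrite mem_iota; apply/mapP/andP => [[i _ ->]|]; first by split; rewrite // add1n ltnS; exact: ltn_ord.
case: e => [[]//|e [_ en]]; have {}en : e < n by [].
exists ((s^-1)%g (Ordinal en)); first by rewrite mem_enum.
by rewrite permKV.
Qed.

Lemma perm_word_uniq n (s : 'S_n) : uniq (perm_word s).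
Proof. by rewrite (perm_uniq (perm_word_perm s)) iota_uniq. Qed.

Lemma val_tperm n (i j x : 'I_n) : val j = i.+1 -> val (tperm i j x) = adj_swap i x.
Proof.
move=> ij; rewrite /adj_swap; case: tpermP => [->|->|xi xj].
- by rewrite eqxx.
- by rewrite ij eqxx gtn_eqF.
- by rewrite -ij !ifF //; apply/negbTE/eqP => /val_inj.
Qed.

Lemma adj_swapS i x : adj_swap i.+1 x.+1 = (adj_swap i x).+1.
Proof. by rewrite /adj_swap !eqSS; case: eqP => // _; case: eqP. Qed.

Lemma perm_word_tperm n (s : 'S_n) (i j : 'I_n) : val j = i.+1 ->
  perm_word (s * tperm i j)%g = map (adj_swap i.+1) (perm_word s).
Proof.
move=> ij; rewrite /perm_word -map_comp; apply: eq_map => p /=.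
by rewrite permM adj_swapS -(val_tperm _ ij).
Qed.

(** Exchanging two consecutive values only affects the inversion formed by their
    positions. *)
Lemma perm_inv_tperm n (s : 'S_n) (i j : 'I_n) : val j = i.+1 ->
  (s^-1)%g j < (s^-1)%g i -> Defs.perm_inv s = (Defs.perm_inv (s * tperm i j)%g).+1.
Proof.
move=> ij; set p0 := (s^-1)%g j; set q0 := (s^-1)%g i => pq.
have sp : s p0 = j by rewrite permKV.
have sq : s q0 = i by rewrite permKV.
pose t := (s * tperm i j)%g.
have inv0 : (p0, q0) \notin [set p : 'I_n * 'I_n | (p.1 < p.2) && (t p.2 < t p.1)].
  by rewrite inE /= !permM sp sq tpermL tpermR ij pq /=; lia.
have := cardsU1 (p0, q0) [set p : 'I_n * 'I_n | (p.1 < p.2) && (t p.2 < t p.1)].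
rewrite inv0 add1n /Defs.perm_inv => <-.
congr #|pred_of_set _|; apply/setP => -[p q]; rewrite !inE /= xpair_eqE /= !permM.
rewrite -[nat_of_ord (tperm _ _ (s q))]/(val _) -[nat_of_ord (tperm _ _ (s p))]/(val _).
rewrite !(val_tperm _ ij).
have seq_eq x y : (val (s x) == val y) = (x == (s^-1)%g y).
  by apply/eqP/eqP => [/val_inj <-|->]; rewrite ?permK ?permKV.
have pq' : (p0 == q0) = false by apply/negbTE; apply: contraTneq pq => ->; rewrite ltnn.
have [->|pp0] := eqVneq p p0; have [->|qq0] := eqVneq q q0.
- by rewrite pq /= sp sq ij ltnSn.
- rewrite /= adj_swap_ltn // -ij !seq_eq -/p0 -/q0 ?pq' ?andbF //.
  by rewrite (negbTE qq0).
- rewrite /= adj_swap_ltn // -ij !seq_eq -/p0 -/q0 ?[q0 == p0]eq_sym ?pq' ?andbF //.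
  by rewrite (negbTE pp0) andbF.
- have [qp|nqp] := boolP ((p == q0) && (q == p0)).
    have [/eqP -> /eqP ->] := andP qp.
    by rewrite sp sq ltnNge ltnW.
  rewrite /= adj_swap_ltn // -ij !seq_eq -/p0 -/q0 ?(negbTE pp0) ?andbF //.
  by rewrite andbC.
Qed.

Section Sign.
Variable k : comPzRingType.

Definition signed_fundamental n (s : 'S_n) : oddA k :=
  ((-1) ^+ Defs.perm_inv s *: fundamental_qsym k (perm_comp s))%R.

Lemma sign_tperm n (s : 'S_n) (i j : 'I_n) : val j = i.+1 ->
  ((-1) ^+ Defs.perm_inv (s * tperm i j)%g = - (-1) ^+ Defs.perm_inv s :> k)%R.
Proof.
move=> ij; have [ji|] := ltnP ((s^-1)%g j) ((s^-1)%g i).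
  by rewrite (perm_inv_tperm ij ji) exprS mulN1r opprK.
rewrite leq_eqVlt => /predU1P[/val_inj/perm_inj e|ji]; first by move/eqP: ij; rewrite e ltn_eqF.
rewrite [in RHS](_ : s = s * tperm i j * tperm i j)%g; last by rewrite -mulgA tperm2 mulg1.
rewrite (perm_inv_tperm (s := (s * tperm i j)%g) ij); last first.
  by rewrite invMg tpermV !permM tpermL tpermR.
by rewrite exprS mulN1r -mulgA tperm2 mulg1.
Qed.

Definition dual_perm a n (s : 'S_n.+1) : 'S_n.+1 :=
  if dual_site a (perm_word s) is Some j then (s * tperm (inord j.-1) (inord j))%g else s.

(** The relabelling turns bac into cab and bca into acb, and conversely. *)
Lemma dual_site_relabel a W : dual_site a (map (dual_relabel a W) W) = dual_site a W.
Proof.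
set s := dual_relabel a W.
have fE : [seq z <- map s W | a <= z <= a.+2] = map s [seq z <- W | a <= z <= a.+2].
  rewrite filter_map; congr map; apply: eq_filter => z /=; rewrite /s /dual_relabel.
  case E : dual_site => [j|] //=.
  have [x [y [t [_ [_ jE]]]]] := dual_siteP E.
  rewrite /adj_swap; have [->|zj] := eqVneq z j; first by lia.
  by have [->|zj1] := eqVneq z j.+1; lia.
case E : (dual_site a W) => [j|]; last first.
  rewrite -E; congr dual_site; rewrite -[RHS]map_id; apply: eq_map => z.
  by rewrite /s /dual_relabel E.
have sE : s = adj_swap j by rewrite /s /dual_relabel E.
have [x [y [t [fW [xt yj]]]]] := dual_siteP E.
case: yj xt fW => [] [-> ja] xt fW; rewrite ja.
  have ay : adj_swap j a = a by rewrite adj_swapD //; lia.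
  apply: dual_site_upper; rewrite fE fW sE /= ay.
  by case: xt => [] [-> ->]; rewrite adj_swapL adj_swapR -ja; [right|left].
have ay : adj_swap j a.+2 = a.+2 by rewrite adj_swapD //; lia.
apply: dual_site_lower; rewrite fE fW sE /= ay.
by case: xt => [] [-> ->]; rewrite adj_swapL adj_swapR -ja; [left|right].
Qed.

Lemma dual_site_bound a n (s : 'S_n.+1) j : dual_site a (perm_word s) = Some j ->
  0 < a -> 0 < j <= n.
Proof.
move=> E a0; have [x [y [t [fW [xt yj]]]]] := dual_siteP E.
have H z : z \in [:: x; y; t] -> z <= n.+1.
  rewrite -fW mem_filter (perm_mem (perm_word_perm s)) mem_iota => /and3P[_ _]; lia.
have hx := H x; have ht := H t; rewrite !inE !eqxx !orbT in hx ht.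
by have := hx isT; have := ht isT; lia.
Qed.

Lemma dual_perm_word a n (s : 'S_n.+1) : 0 < a ->
  perm_word (dual_perm a s) = map (dual_relabel a (perm_word s)) (perm_word s).
Proof.
move=> a0; rewrite /dual_perm /dual_relabel; case E : dual_site => [j|] /=; last by rewrite map_id.
have jn := dual_site_bound E a0.
rewrite perm_word_tperm /= !inordK ?prednK //; lia.
Qed.

Lemma dual_permK a n : 0 < a -> involutive (@dual_perm a n).
Proof.
move=> a0 s; rewrite {1}/dual_perm dual_perm_word // dual_site_relabel /dual_perm.
by case: dual_site => // j; rewrite -mulgA tperm2 mulg1.
Qed.

(** Swapped letters are never neighbours in the word, so no descent is created or
    destroyed. *)
Lemma perm_comp_dual a n (s : 'S_n.+1) : 0 < a -> perm_comp (dual_perm a s) = perm_comp s.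
Proof.
move=> a0; rewrite /perm_comp dual_perm_word //; congr comp_of_set; apply/setP => i.
rewrite !inE; set W := perm_word s.
have iW : i.+1 < size W by rewrite size_perm_word ltnS; apply: leq_trans (ltn_ord i) _.
rewrite !(nth_map 0) // ?(ltnW iW) //.
apply: (dual_relabel_adjacent (X := [seq t <- take i W | a <= t <= a.+2])
  (Y := [seq t <- drop i.+2 W | a <= t <= a.+2]) _).2.
rewrite -!filter_cat; congr filter; rewrite -[LHS](cat_take_drop i); congr cat.
by rewrite (drop_nth 0) ?(ltnW iW) // (drop_nth 0 iW).
Qed.

(** This is sigma_T for T = [tableau_of y]. Keeping n apart from y puts the classes that
    are compared over the same symmetric group. *)
Definition tableau_class n (y : seq nat) : oddA k :=
  (\sum_(s : 'S_n | schensted (perm_word s) == tableau_of y) signed_fundamental s)%R.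

(** The letters u, v, t are the rows of a, a+1, a+2, and t <= u < v means that the reading
    word has them in the order bac; after the move the order is cab. Dual equivalence
    is a sign-reversing involution between the two classes that keeps descents. On a
    permutation of the class it may swap a, a+1 as well as a+1, a+2. *)
Lemma tableau_class_move p u v t q : t <= u < v ->
  let n := size (p ++ [:: u; v; t] ++ q) in
  tableau_class n (p ++ [:: u; v; t] ++ q) = (- tableau_class n (p ++ [:: u; t; v] ++ q))%R.
Proof.
move=> tuv; rewrite /=.
have -> : size (p ++ [:: u, v, t & q]) = (size p + (size q).+2).+1 by rewrite size_cat /= addnS.
set n := _ + _; set y := p ++ _; set y' := p ++ _; pose a := (size p).+1.
have ny : size y = n.+1 by rewrite size_cat /= addnS.
have ny' : size y' = n.+1 by rewrite size_cat /= addnS.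
have nthp i s : nth 0 (p ++ s) (size p + i) = nth 0 s i.
  by rewrite nth_cat ltnNge leq_addr addKn.
have y0 : nth 0 y (size p) = u by rewrite -[size p]addn0 nthp.
have y1 : nth 0 y (size p).+1 = v by rewrite -[(size p).+1]addn1 nthp.
have y2 : nth 0 y (size p).+2 = t by rewrite -[(size p).+2]addn2 nthp.
have y0' : nth 0 y' (size p) = u by rewrite -[size p]addn0 nthp.
have y1' : nth 0 y' (size p).+1 = t by rewrite -[(size p).+1]addn1 nthp.
have y2' : nth 0 y' (size p).+2 = v by rewrite -[(size p).+2]addn2 nthp.
have fy : [seq z <- reading (tableau_of y) | a <= z <= a.+2] = [:: a.+1; a; a.+2].
  apply: filter_reading_tableau_of; last by move=> e; rewrite !inE /a ny /n; lia.
  by rewrite /= /reading_order /a /= y0 y1 y2; lia.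
have fy' : [seq z <- reading (tableau_of y') | a <= z <= a.+2] = [:: a.+2; a; a.+1].
  apply: filter_reading_tableau_of; last by move=> e; rewrite !inE /a ny' /n; lia.
  by rewrite /= /reading_order /a /= y0' y1' y2'; lia.
have sy : dual_relabel a (reading (tableau_of y)) = adj_swap a.+1.
  by rewrite /dual_relabel dual_site_upper //; left.
have sy' : dual_relabel a (reading (tableau_of y')) = adj_swap a.+1.
  by rewrite /dual_relabel dual_site_upper //; right.
have dualP (s : 'S_n.+1) : schensted (perm_word s) = tableau_of y ->
    schensted (perm_word (dual_perm a s)) = tableau_of y'.
  move=> sE; rewrite dual_perm_word // schensted_dual ?perm_word_uniq // sE sy.
  by apply: tableau_of_swap; lia.
have dualP' (s : 'S_n.+1) : schensted (perm_word s) = tableau_of y' ->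
    schensted (perm_word (dual_perm a s)) = tableau_of y.
  move=> sE; rewrite dual_perm_word // schensted_dual ?perm_word_uniq // sE sy'.
  by apply: tableau_of_swap; lia.
rewrite /tableau_class [in RHS](reindex_inj (inv_inj (@dual_permK a n isT))) -sumrN /=.
apply: eq_big => [s|s /eqP sE].
  apply/eqP/eqP => [/dualP //|/dualP']; by rewrite dual_permK.
have := dualP s sE; rewrite /signed_fundamental perm_comp_dual // -scaleNr /dual_perm.
case E : dual_site => [j|]; last first.
  by rewrite sE => yy'; move: fy; rewrite yy' fy' => -[]; lia.
have jn := dual_site_bound E isT; move=> _; rewrite sign_tperm ?opprK //.
have [j0 jn1] := andP jn.
by rewrite /= !inordK ?prednK // ltnW.
Qed.
End Sign.

Local Open Scope ring_scope.

(** * Refinement of compositions and monomial words *)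

Section Compositions.
Local Open Scope nat_scope.

Lemma sumn_take_le i j (b : seq nat) : i <= j -> sumn (take i b) <= sumn (take j b).
Proof.
by elim: b i j => [|x b IHb] [|i] [|j] //=; rewrite ltnS leq_add2l; apply: IHb.
Qed.

Lemma sumn_take_bounds i (b : seq nat) : all (fun m => 0 < m) b ->
  (0 < sumn (take i b) < sumn b) = (0 < i < size b).
Proof.
move=> b0; have gt0 (s : seq nat) : {subset s <= b} -> (0 < sumn s) = (0 < size s).
  by case: s => //= x s sb; rewrite ltn_addr // (allP b0) // sb ?mem_head.
have ht : {subset take i b <= b} by move=> x; apply: mem_take.
have hd : {subset drop i b <= b} by move=> x; apply: mem_drop.
have := gt0 _ ht; have := gt0 _ hd; have : sumn b = sumn (take i b) + sumn (drop i b).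
  by rewrite -sumn_cat cat_take_drop.
by rewrite size_drop size_take; case: ifP => ib; lia.
Qed.

Lemma mem_des_comp b m : all (fun m => 0 < m) b ->
  (m \in des_comp b) <-> 0 < m < sumn b /\ exists i, m = sumn (take i b).
Proof.
move=> b0; split=> [/mapP[i] | [+ [i mE]]].
  by rewrite mem_iota => ib ->; rewrite sumn_take_bounds //; split; [lia | exists i].
rewrite mE sumn_take_bounds // => ib; apply/mapP; exists i => //.
by rewrite mem_iota; lia.
Qed.

Lemma refines_sub a b : all (fun m => 0 < m) a -> all (fun m => 0 < m) b ->
  refines b a -> {subset des_comp a <= des_comp b}.
Proof.
move=> a0 b0 [ss [bE aE]] m /(mem_des_comp _ a0)[ma [i mE]]; apply/mem_des_comp => //.
rewrite bE sumn_flatten -aE; split=> //.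
exists (size (flatten (take i ss))); rewrite mE aE -map_take -sumn_flatten.
have -> : flatten ss = flatten (take i ss) ++ flatten (drop i ss).
  by rewrite -flatten_cat cat_take_drop.
by rewrite take_size_cat.
Qed.

(** Cut b where its partial sum is the first part of a, and continue with what is left. *)
Lemma refines_of_sums a b : all (fun m => 0 < m) b -> sumn a = sumn b ->
  (forall i, exists j, sumn (take i a) = sumn (take j b)) -> refines b a.
Proof.
elim: a b => [|x a IHa] b b0 sab H.
  by exists [::]; case: b b0 sab {H} => //= y b /andP[y0 _]; lia.
have [j /= xE] := H 1; rewrite take0 addn0 in xE.
have sb : sumn b = x + sumn (drop j b) by rewrite xE -sumn_cat cat_take_drop.
have [||i|ss [dE aE]] := IHa (drop j b).
- by apply/allP => m /mem_drop; apply: (allP b0).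
- by move: sab => /=; lia.
- have [j' /= jE] := H i.+1; have [jj|jj] := leqP j j'; last first.
    exists 0; have := sumn_take_le b (ltnW jj); rewrite -xE -jE take0 /=; lia.
  exists (j' - j); apply: (@addnI x); rewrite jE xE -sumn_cat -{1}(subnKC jj).
  by rewrite takeD.
by exists (take j b :: ss); rewrite /= -dE -aE -xE cat_take_drop.
Qed.

Lemma comp_of_set_pos n (S : {set 'I_n.-1}) :
  all (fun m => 0 < m) (comp_of_set S) /\ sumn (comp_of_set S) = n.
Proof. by have [/andP[? /eqP ?] _] := comp_of_setP S. Qed.

Lemma mem_des_comp_of_set n (S : {set 'I_n.-1}) (i : 'I_n.-1) :
  (i.+1 \in des_comp (comp_of_set S)) = (i \in S).
Proof.
have [_ ->] := comp_of_setP S; rewrite /cuts -(mem_enum S i).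
by apply: (mem_map (f := fun j : 'I_n.-1 => (val j).+1)) => x y [] /val_inj.
Qed.

Lemma refines_comp_of_set n (S D : {set 'I_n.-1}) :
  refines (comp_of_set D) (comp_of_set S) <-> S \subset D.
Proof.
have [S0 Sn] := comp_of_set_pos S; have [D0 Dn] := comp_of_set_pos D; split=> [SD|/fintype.subsetP SD].
  apply/fintype.subsetP => i; rewrite -!mem_des_comp_of_set; exact: refines_sub.
apply: refines_of_sums => //; first by rewrite Sn.
move=> i; have [iS|] := boolP (0 < i < size (comp_of_set S)); last first.
  rewrite negb_and -leqNgt leqn0 -leqNgt => /orP[/eqP->|iS]; first by exists 0; rewrite !take0.
  by exists (size (comp_of_set D)); rewrite take_size take_oversize // Sn Dn.
have : sumn (take i (comp_of_set S)) \in des_comp (comp_of_set S).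
  by apply/mem_des_comp => //; rewrite sumn_take_bounds //; split=> //; exists i.
have [_ ->] := comp_of_setP S; case/mapP => j; rewrite mem_enum => /SD jD ->.
have : (val j).+1 \in des_comp (comp_of_set D) by rewrite mem_des_comp_of_set.
by case/mem_des_comp => // _ [i' iE]; exists i'.
Qed.

Lemma des_comp_cons x y a :
  des_comp (x :: y :: a) = x :: map (addn x) (des_comp (y :: a)).
Proof.
rewrite /des_comp /= addn0; congr cons; rewrite -[2]addn1 iotaDl -!map_comp.
by apply: eq_map.
Qed.

Definition run_word (a i : seq nat) : seq nat := flatten [seq nseq p.1 p.2 | p <- zip a i].

(** The monomials of M_a, described by the strict ascents of their words, which is what
    the refinement order compares. *)
Lemma run_word_ascents a v : all (fun m => 0 < m) a ->
  (exists i, [/\ sorted ltn i, size i = size a & v = run_word a i]) <->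
  size v = sumn a /\ forall p, p.+1 < size v ->
    if p.+1 \in des_comp a then nth 0 v p < nth 0 v p.+1 else nth 0 v p == nth 0 v p.+1.
Proof.
elim: a v => [|x a IHa] v /=.
  move=> _; split=> [[i [_ + ->]] | [/size0nil -> _]]; last by exists [::].
  by move/size0nil->.
case/andP => x0 a0; have desE p : (p.+1 \in des_comp (x :: a)) =
    (if p.+1 < x then false else if p.+1 == x then a != [::] else p.+1 - x \in des_comp a).
  case: a a0 {IHa} => [|y a] a0; first by rewrite /des_comp /= if_same if_same.
  rewrite des_comp_cons inE; case: ltngtP => [px|px|->] //=.
    apply/negbTE/mapP => -[m /(mem_des_comp _ a0)]; lia.
  by rewrite -{1}(subnKC (ltnW px)) mem_map //; exact: addnI.
split=> [[i [si sz vE]] | [sz H]].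
  case: i si sz vE => [|i0 i] //= si [sz] vE.
  have [|sv H] := (IHa (run_word a i) a0).1.
    by exists i; split=> //; apply: path_sorted si.
  have {}vE : v = nseq x i0 ++ run_word a i by [].
  split=> [|p pv]; first by rewrite vE size_cat size_nseq sv.
  rewrite desE vE !nth_cat size_nseq !nth_nseq.
  case: (ltngtP p.+1 x) => [px|px|pE]; first by rewrite eqxx.
    rewrite /= subSn //.
    by apply: H; rewrite vE size_cat size_nseq in pv; lia.
  rewrite pE subnn; case: a i a0 si sz sv vE {H IHa desE} => [|y a] [|i1 i] //=.
    by move=> _ _ _ _ vE; rewrite vE size_cat size_nseq /= addn0 pE ltnn in pv.
  by case/andP=> y0 _ /andP[i01 _] _ _ _; rewrite /run_word /=; case: y y0.
have take_v : take x v = nseq x (nth 0 v 0).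
  have const p : p < x -> nth 0 v p = nth 0 v 0.
    elim: p => // p IHp px; rewrite -IHp ?(ltnW px) //; have := H p.
    by rewrite desE px => /(_ _)/eqP -> //; rewrite sz ltn_addr.
  apply: (@eq_from_nth _ 0); first by rewrite size_takel ?size_nseq // sz leq_addr.
  move=> p; rewrite size_takel ?sz ?leq_addr // => px.
  by rewrite nth_take // nth_nseq px const.
have [|i [si szi vE]] := (IHa (drop x v) a0).2.
  rewrite size_drop sz addKn; split=> // p px; rewrite !nth_drop addnS.
  have E1 : (x + p.+1 < x) = false by lia.
  have E2 : (x + p.+1 == x) = false by lia.
  by have := H (x + p); rewrite desE -addnS E1 E2 addKn; apply; rewrite sz ltn_add2l.
exists (nth 0 v 0 :: i); split; last 2 first.
- by rewrite /= szi.
- by rewrite /run_word /= -/(run_word a i) -vE -take_v cat_take_drop.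
case: i a vE szi si a0 sz H desE {IHa} => [|i1 i] [|y a] //= vE _ -> /andP[y0 _] sz H desE.
rewrite andbT; have := H x.-1; rewrite desE prednK // ltnn eqxx sz /=.
have -> : nth 0 v x = i1 by rewrite -[x in LHS]addn0 -nth_drop vE /run_word /=; case: y y0 {vE desE sz H}.
have -> : nth 0 v x.-1 = nth 0 v 0.
  have xx : x.-1 < x by rewrite prednK.
  by rewrite -(nth_take 0 xx) take_v nth_nseq xx.
by apply; lia.
Qed.
End Compositions.

(** * Standardization of words with anticommuting letters *)

Definition descents n (s : 'S_n) : {set 'I_n.-1} :=
  [set i : 'I_n.-1 | (nth 0%N (perm_word s) i.+1 < nth 0%N (perm_word s) i)%N].

Definition lex_pair (x y : nat * nat) : bool :=
  (x.1 < y.1)%N || (x.1 == y.1) && (x.2 < y.2)%N.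

Lemma lex_pair_trans : transitive lex_pair.
Proof. by move=> [b1 b2] [a1 a2] [c1 c2]; rewrite /lex_pair /=; lia. Qed.

Lemma lex_pair_irr : irreflexive lex_pair.
Proof. by move=> [b1 b2]; rewrite /lex_pair /=; lia. Qed.

Lemma nth_perm_word_lt n (s : 'S_n) i (lt_in : (i < n)%N) :
  nth 0%N (perm_word s) i = (s (Ordinal lt_in)).+1.
Proof. exact: (nth_perm_word s (Ordinal lt_in)). Qed.

(** For s of descent set D this says that v weakly increases, and strictly at the places
    of D. Ordering pairs of letters makes the condition transitive, hence valid for
    distant positions as well. *)
Definition compatible n (s : 'S_n) (v : seq nat) : bool :=
  (size v == n) && sorted lex_pair (zip v (perm_word s)).

Section Series.
Variable k : comPzRingType.
Local Notation S := (ncseries k).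

Lemma sum_ncE (I : Type) (r : seq I) (P : pred I) (F : I -> S) w :
  (\sum_(i <- r | P i) F i) w = \sum_(i <- r | P i) F i w.
Proof. by apply: (big_morph (fun f : S => f w)). Qed.

Lemma oddA_pi_sum (I : Type) (r : seq I) (P : pred I) (F : I -> S) :
  oddA_pi (\sum_(i <- r | P i) F i) = \sum_(i <- r | P i) oddA_pi (F i).
Proof.
apply: (big_morph (@oddA_pi k) (@oddA_piD k)).
have := oddA_piD (0 : S) 0; rewrite addr0 => /(congr1 (fun x => x - oddA_pi (0 : S))).
by rewrite addrK subrr.
Qed.

Lemma fundamental_qsymE n (a : seq nat) : sumn a = n ->
  fundamental_qsym k a = \sum_(D : {set 'I_n.-1} | `[< refines (comp_of_set D) a >])
     monomial_qsym k (comp_of_set D).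
Proof. by move=> <-. Qed.

Lemma monomial_qsymE n (D : {set 'I_n.-1}) : monomial_qsym k (comp_of_set D) =
  oddA_pi (fun v => ((size v == n) &&
     [forall i : 'I_n.-1, if i \in D then (nth 0%N v i < nth 0%N v i.+1)%N
                          else nth 0%N v i == nth 0%N v i.+1])%:R).
Proof.
rewrite /monomial_qsym; congr oddA_pi; apply/funext => v; congr (nat_of_bool _)%:R.
have [D0 Dn] := comp_of_set_pos D.
apply/asboolP/idP => [/(run_word_ascents _ D0)[sz H] | /andP[/eqP sz /forallP H]].
  rewrite sz Dn eqxx; apply/forallP => i; rewrite -mem_des_comp_of_set.
  have {}H := H i; rewrite sz Dn in H; have := H _; case: ifP => _; apply.
    by have := ltn_ord i; lia.
  by have := ltn_ord i; lia.
apply/(run_word_ascents _ D0); rewrite sz Dn; split=> // p pn.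
have pn' : (p < n.-1)%N by lia.
have := H (Ordinal pn'); rewrite -mem_des_comp_of_set /=.
by case: ifP.
Qed.

(** Grouped by their sets of strict ascents, which have to contain the descents of s, the
    compatible words make up the monomial functions of the refinements. *)
Lemma fundamental_qsym_compatible n (s : 'S_n) :
  fundamental_qsym k (perm_comp s) = oddA_pi (fun v => (compatible s v)%:R).
Proof.
have [_ Sn] := comp_of_set_pos (descents s).
rewrite (fundamental_qsymE (n := n)) //.
under eq_bigr do rewrite monomial_qsymE.
rewrite -oddA_pi_sum; congr oddA_pi; apply/funext => v; rewrite sum_ncE.
have [sz|sz] := eqVneq (size v) n; last first.
  by rewrite /compatible (negbTE sz) /= big1.
pose asc := [set i : 'I_n.-1 | (nth 0%N v i < nth 0%N v i.+1)%N].
pose wk := [forall i : 'I_n.-1, (nth 0%N v i <= nth 0%N v i.+1)%N].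
have E (D : {set 'I_n.-1}) :
    [forall i : 'I_n.-1, if i \in D then (nth 0%N v i < nth 0%N v i.+1)%N
                         else nth 0%N v i == nth 0%N v i.+1] = wk && (D == asc).
  apply/forallP/andP => [H | [/forallP H /eqP ->] i]; last first.
    by rewrite inE; have := H i; case: ltngtP.
  split.
    by apply/forallP => i; have := H i; case: ifP => _; [apply: ltnW | move/eqP->].
  apply/eqP/setP => i; rewrite inE; have := H i.
  by case: ifP => _ => [->|/eqP ->]; rewrite ?ltnn.
under eq_bigr do rewrite E.
have -> : compatible s v = (descents s \subset asc) && wk.
  rewrite /compatible sz eqxx /=.
  apply/(sortedP (0, 0)%N)/andP => [H | [/fintype.subsetP H1 /forallP H2] i].
    have {}H (i : 'I_n.-1) : lex_pair (nth 0%N v i, nth 0%N (perm_word s) i)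
                               (nth 0%N v i.+1, nth 0%N (perm_word s) i.+1).
      have := H i; rewrite !nth_zip ?size_perm_word ?sz //; apply.
      by rewrite size_zip sz size_perm_word minnn; have := ltn_ord i; lia.
    split.
      by apply/fintype.subsetP => i; rewrite !inE; have := H i; rewrite /lex_pair /=; lia.
    by apply/forallP => i; have := H i; rewrite /lex_pair /=; lia.
  rewrite size_zip sz size_perm_word minnn => i_n; rewrite !nth_zip ?size_perm_word ?sz //.
  have i_n' : (i < n.-1)%N by lia.
  have := H1 (Ordinal i_n'); have := H2 (Ordinal i_n'); rewrite !inE /lex_pair /=.
  have : nth 0%N (perm_word s) i <> nth 0%N (perm_word s) i.+1.
    by move/eqP; rewrite nth_uniq ?perm_word_uniq ?size_perm_word //; lia.
  by lia.
have Psub D : `[< refines (comp_of_set D) (perm_comp s) >] = (descents s \subset D).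
  by apply/asboolP/idP => /refines_comp_of_set.
under eq_bigl do rewrite Psub.
rewrite big_mkcond (bigD1 asc) //= eqxx andbT big1 ?addr0 => [|D Dasc]; last first.
  by rewrite (negbTE Dasc) !andbF if_same.
by case: (_ \subset _).
Qed.

Lemma nc_scalerAl (c : k) (f g : S) : (c *: f) * g = c *: (f * g).
Proof. exact: esym (nc_scaleAl c f g). Qed.

Definition word_series (u : seq nat) : S := fun w => (w == u)%:R.

Lemma word_series_cons x u : word_series (x :: u) = nc_var k x * word_series u.
Proof.
apply/funext => -[|y w]; first by rewrite [RHS]nc_mul_nil mul0r.
rewrite [RHS]nc_mul_cons mul0r add0r /word_series eqseq_cons.
have -> : nc_cut y (nc_var k x) = (y == x)%:R *: (1 : S).
  apply/funext => v; rewrite /nc_cut /nc_var eqseq_cons /GRing.scale /= /nc_scale.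
  by case: (y == x); rewrite ?mul1r ?mul0r.
rewrite -[RHS]/(((y == x)%:R *: (1 : S) * (word_series u : S) : S) w) nc_scalerAl mul1r.
rewrite /GRing.scale /= /nc_scale /word_series.
by case: (y == x); rewrite ?mul1r ?mul0r.
Qed.

Lemma word_series_cat u v : word_series (u ++ v) = word_series u * word_series v.
Proof.
elim: u => [|x u IHu]; last by rewrite cat_cons !word_series_cons IHu mulrA.
by rewrite -[LHS]mul1r.
Qed.

Lemma anticomm_ideal_swap i j : i != j ->
  nc_var k i * nc_var k j + nc_var k j * nc_var k i \in @anticomm_ideal k.
Proof.
move=> ij; apply/anticomm_idealP => J [_]; apply.
have [ji|ij'] := ltnP j i; first by exists i, j.
by exists j, i; rewrite addrC ltn_neqAle ij.
Qed.

Lemma word_series_swap p x y q : x != y ->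
  word_series (p ++ x :: y :: q) + word_series (p ++ y :: x :: q) \in @anticomm_ideal k.
Proof.
move=> xy; rewrite !word_series_cat !word_series_cons !mulrA -!mulrDl -!(mulrA (word_series p)) -mulrDr.
by rewrite anticomm_idealMr // anticomm_idealMl // anticomm_ideal_swap.
Qed.

Definition relabel n (s : 'S_n) (v : seq nat) : seq nat :=
  [seq nth 0%N v (s i) | i : 'I_n].

Lemma size_relabel n (s : 'S_n) v : size (relabel s v) = n.
Proof. by rewrite size_map size_enum_ord. Qed.

Lemma nth_relabel n (s : 'S_n) v (i : 'I_n) : nth 0%N (relabel s v) i = nth 0%N v (s i).
Proof. by rewrite (nth_map i) ?nth_ord_enum ?size_enum_ord. Qed.

Lemma relabelM n (s t : 'S_n) v : relabel t (relabel s v) = relabel (t * s)%g v.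
Proof.
apply: (@eq_from_nth _ 0%N); rewrite !size_relabel // => i iN.
by rewrite -[i]/(val (Ordinal iN)) !nth_relabel permM.
Qed.

Lemma relabel1 n v : size v = n -> relabel (1 : 'S_n)%g v = v.
Proof.
move=> sv; apply: (@eq_from_nth _ 0%N); rewrite !size_relabel // => i iN.
by rewrite -[i]/(val (Ordinal iN)) !nth_relabel perm1.
Qed.

Lemma compatible_lt n (s : 'S_n) v (p q : 'I_n) : compatible s v -> (p < q)%N ->
  (nth 0%N v p < nth 0%N v q)%N || (nth 0%N v p == nth 0%N v q) && (s p < s q)%N.
Proof.
case/andP => /eqP sv; have sz : size (zip v (perm_word s)) = n.
  by rewrite size_zip sv size_perm_word minnn.
move/(sorted_ltn_nth lex_pair_trans (0, 0)%N)/(_ p q); rewrite !inE sz !ltn_ord => /(_ isT isT) H.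
by move/H; rewrite !nth_zip ?size_perm_word // !nth_perm_word.
Qed.

Lemma inverse_descent n (s : 'S_n) : s != 1%g ->
  exists i j : 'I_n, val j = i.+1 /\ ((s^-1)%g j < (s^-1)%g i)%N.
Proof.
move=> s1; apply: contrapT => H; case/eqP: s1; apply/eqP; rewrite -eq_invg1; apply/eqP.
have ss : sorted ltn (perm_word (s^-1)%g).
  apply/(sortedP 0%N) => i; rewrite size_perm_word => iN.
  rewrite (nth_perm_word_lt _ (ltnW iN)) (nth_perm_word_lt _ iN) /= ltnS ltn_neqAle; apply/andP; split.
    by rewrite (inj_eq val_inj) (inj_eq perm_inj) -(inj_eq val_inj) /= ltn_eqF.
  by rewrite leqNgt; apply/negP => lt; apply: H; exists (Ordinal (ltnW iN)), (Ordinal iN).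
have E : perm_word (s^-1)%g = iota 1 n.
  apply: (irr_sorted_eq ltn_trans ltnn) => //; first exact: iota_ltn_sorted.
  exact: perm_mem (perm_word_perm _).
apply/permP => i; apply: val_inj; rewrite perm1.
by have := nth_perm_word (s^-1)%g i; rewrite E nth_iota // add1n => -[/esym].
Qed.

(** Induction on the number of inversions. If the value i+1 precedes i in s, then the
    letters of the word at the positions i and i+1 are out of order, and they are
    distinct because v is compatible with s. Exchanging them costs a sign and removes
    one inversion from s. *)
Lemma word_series_sort n (s : 'S_n) v : compatible s v ->
  word_series (relabel (s^-1)%g v) - (-1) ^+ Defs.perm_inv s *: word_series v \in @anticomm_ideal k.
Proof.
have [m] := ubnP (Defs.perm_inv s); elim: m s => // m IHm s sm sv.
have [s1|/inverse_descent[i [j [ij ji]]]] := eqVneq s 1%g.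
  rewrite s1 invg1 relabel1; last by case/andP: sv => /eqP.
  have -> : Defs.perm_inv (1%g : 'S_n) = 0%N.
    by apply: eq_card0 => -[p q]; rewrite !inE /= !perm1; lia.
  by rewrite expr0 scale1r subrr rpred0.
have invE := perm_inv_tperm ij ji; set t := (s * tperm i j)%g in invE.
have tv : compatible t v.
  case/andP: (sv) => szv _; rewrite /compatible szv /=; apply/(sortedP (0, 0)%N) => p.
  rewrite size_zip (eqP szv) size_perm_word minnn => pn.
  rewrite !nth_zip ?size_perm_word ?(eqP szv) // (nth_perm_word_lt _ (ltnW pn)).
  rewrite (nth_perm_word_lt _ pn).
  have := compatible_lt (p := Ordinal (ltnW pn)) (q := Ordinal pn) sv (ltnSn p).
  rewrite /lex_pair /= ltnS !permM; set P := Ordinal _; set Q := Ordinal _.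
  case/orP => [->//|/andP[-> pq]]; rewrite orbC.
  rewrite -[nat_of_ord (tperm _ _ (s P))]/(val _) -[nat_of_ord (tperm _ _ (s Q))]/(val _).
  rewrite !(val_tperm _ ij) adj_swap_ltn ?pq //; last by move: pq; lia.
  apply/negP => /andP[/eqP/val_inj sP]; rewrite -ij => /eqP/val_inj sQ.
  by move: ji; rewrite -sP -sQ !permK /=; lia.
have tE : t^-1%g = (tperm i j * s^-1)%g by rewrite invMg tpermV.
set u := relabel (s^-1)%g v.
have uE : u = take i u ++ nth 0%N u i :: nth 0%N u i.+1 :: drop i.+2 u.
  have iu : (i.+1 < size u)%N by rewrite size_relabel -ij ltn_ord.
  by rewrite -(drop_nth 0%N iu) -(drop_nth 0%N (ltnW iu)) cat_take_drop.
have u'E : relabel (t^-1)%g v = take i u ++ nth 0%N u i.+1 :: nth 0%N u i :: drop i.+2 u.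
  rewrite tE -relabelM -/u; apply: (@eq_from_nth _ 0%N).
    by transitivity (size u); [rewrite !size_relabel | rewrite {1}uE !size_cat].
  move=> p; rewrite size_relabel => pn; rewrite -[p]/(val (Ordinal pn)) nth_relabel.
  have iu : (i < size u)%N by rewrite size_relabel ltn_ord.
  rewrite /= nth_cat size_takel ?(ltnW iu) //.
  rewrite -[nat_of_ord (tperm _ _ _)]/(val _) (val_tperm _ ij) /= /adj_swap.
  case: ltngtP => [pi|pi|->].
  - by rewrite ltn_eqF ?ltnS ?(ltnW pi) // nth_take.
  - have [->|pi1] := eqVneq p i.+1; first by rewrite subSn // subnn.
    have -> : (p - i)%N = (p - i.+2).+2 by lia.
    by rewrite /= nth_drop subnKC //; lia.
  - by rewrite subnn.
have u_ne : nth 0%N u i != nth 0%N u i.+1.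
  rewrite -[i.+1]ij !nth_relabel neq_ltn; have := compatible_lt sv ji.
  by rewrite !permKV; move: ij; rewrite -[nat_of_ord j]/(val j) => ->; lia.
have := IHm t _ tv; rewrite invE in sm *; move/(_ sm); rewrite u'E => H.
have := rpredB (word_series_swap (take i u) (drop i.+2 u) u_ne) H; rewrite -uE.
by rewrite opprB addrACA subrr addr0 exprS mulN1r scaleNr opprK.
Qed.

(** The permutation s lists the positions of u by increasing letter, and from left to
    right among equal letters. *)
Definition standardizes n (s : 'S_n) (u : seq nat) : bool :=
  (size u == n) && compatible s (relabel s u).

Lemma sum_indicator (T : eqType) (r : seq T) (x : T) : uniq r ->
  \sum_(v <- r) (v == x)%:R = (x \in r)%:R :> k.
Proof.
elim: r => [|y r IHr] /=; first by rewrite big_nil.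
case/andP => yr ur; rewrite big_cons IHr // inE eq_sym.
by have [->|] := eqVneq x y; rewrite ?(negbTE yr) ?addr0 ?add0r.
Qed.

(** Each word standardized by s is sorted by [word_series_sort]. To add up these
    infinitely many relations, use that the ideal is closed: on a finite set W of
    words a finite sum of them suffices. *)
Lemma standard_series n (s : 'S_n) :
  oddA_pi (fun u => (standardizes s u)%:R : k) = signed_fundamental k s.
Proof.
rewrite /signed_fundamental fundamental_qsym_compatible -oddA_piZ; apply/oddA_piP.
apply/anticomm_idealP; have [I0 ID IM IC] := @smallest_closed_ideal k; apply: IC => W.
set sg := (-1) ^+ _.
(* V collects the sorted words whose relation has a term in W. *)
pose V := undup ([seq v <- W | compatible s v] ++ [seq relabel s u | u <- W & standardizes s u]).
have VP v : v \in V -> compatible s v.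
  rewrite mem_undup mem_cat mem_filter => /orP[/andP[]//|/mapP[u]].
  by rewrite mem_filter => /andP[/andP[_ su] _] ->.
exists (\sum_(v <- V) (word_series (relabel (s^-1)%g v) - sg *: word_series v)).
  apply/anticomm_idealP; rewrite big_seq; apply: rpred_sum => v /VP.
  exact: word_series_sort.
move=> w wW; rewrite sum_ncE.
rewrite (eq_bigr (fun v => word_series (relabel (s^-1)%g v) w - sg * word_series v w)) //.
rewrite sumrB -mulr_sumr -[RHS]/(_ - sg * _); congr (_ - _ * _); last first.
  under eq_bigr do rewrite /word_series eq_sym.
  rewrite sum_indicator ?undup_uniq //; congr (nat_of_bool _)%:R.
  apply/idP/idP => [/VP //|sw]; by rewrite mem_undup mem_cat mem_filter sw wW.
have [sz|sz] := eqVneq (size w) n; last first.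
  rewrite /standardizes (negbTE sz) big1 // => v _; rewrite /word_series.
  by case: eqP => // wE; rewrite wE size_relabel eqxx in sz.
rewrite (eq_big_seq (fun v => (v == relabel s w)%:R : k)) => [|v /VP/andP[/eqP sv _]].
  rewrite sum_indicator ?undup_uniq // /standardizes sz eqxx /=; congr (nat_of_bool _)%:R.
  apply/idP/idP => [/VP //|sw]; rewrite mem_undup mem_cat; apply/orP; right.
  by apply/mapP; exists w; rewrite // mem_filter /standardizes sz eqxx sw wW.
congr (nat_of_bool _)%:R; apply/eqP/eqP => ->; rewrite relabelM ?mulgV ?mulVg relabel1 //.
Qed.
End Series.

(** * Products of complete functions *)

Lemma perm_word_inj n : injective (@perm_word n).
Proof.
move=> s t st; apply/permP => i; apply: val_inj; apply: succn_inj.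
by rewrite -!nth_perm_word st.
Qed.

Lemma perm_word_onto n L : perm_eq L (iota 1 n) -> exists s : 'S_n, perm_word s = L.
Proof.
move=> Ln; have sL : size L = n by rewrite (perm_size Ln) size_iota.
have LP (i : 'I_n) : (0 < nth 0%N L i <= n)%N.
  have : nth 0%N L i \in iota 1 n by rewrite -(perm_mem Ln) mem_nth ?sL.
  by rewrite mem_iota; lia.
have Llt (i : 'I_n) : ((nth 0%N L i).-1 < n)%N by have := LP i; lia.
have f_inj : injective (fun i => Ordinal (Llt i)).
  move=> i j [ij]; apply: val_inj; apply/eqP.
  have uL : uniq L by rewrite (perm_uniq Ln) iota_uniq.
  have := nth_uniq 0%N _ _ uL => /(_ i j); rewrite sL !ltn_ord => /(_ isT isT) /= <-.
  by have := LP i; have := LP j; lia.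
exists (perm f_inj); apply: (@eq_from_nth _ 0%N); rewrite size_perm_word ?sL // => i iN.
rewrite (nth_perm_word_lt _ iN) permE /= prednK //.
by have /andP[] := LP (Ordinal iN).
Qed.

(** The order in which a stable sort of u lists the positions, which are counted from 1 as
    in [perm_word]. *)
Definition place_order (u : seq nat) (e f : nat) : bool :=
  lex_pair (nth 0%N u e.-1, e) (nth 0%N u f.-1, f).

Lemma place_order_trans u : transitive (place_order u).
Proof. by move=> f e g; apply: lex_pair_trans. Qed.

Lemma place_order_irr u : irreflexive (place_order u).
Proof. by move=> e; apply: lex_pair_irr. Qed.

Lemma standardizesE n (s : 'S_n) u :
  standardizes s u = (size u == n) && sorted (place_order u) (perm_word s).
Proof.
rewrite /standardizes /compatible size_relabel eqxx /=; congr andb.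
have -> : zip (relabel s u) (perm_word s) = [seq (nth 0%N u e.-1, e) | e <- perm_word s].
  by rewrite /relabel /perm_word /image_mem zip_map -map_comp.
by rewrite sorted_map.
Qed.

Lemma standardizes_ex n u : size u = n ->
  exists s : 'S_n, forall t : 'S_n, standardizes t u = (t == s).
Proof.
move=> sz; pose le e f := ~~ place_order u f e.
pose L := sort le (iota 1 n).
have le_total : total le by move=> e f; rewrite /le /place_order /lex_pair /=; lia.
have Ln : perm_eq L (iota 1 n) by exact: permEl (perm_sort _ _).
have [s sL] := perm_word_onto Ln.
have Ls : sorted (place_order u) L.
  apply: pairwise_sorted.
  have : pairwise le L.
    rewrite -sorted_pairwise ?sort_sorted // => e f g.
    by rewrite /le /place_order /lex_pair /=; lia.
  have : pairwise [rel x y | x != y] L by rewrite -uniq_pairwise (perm_uniq Ln) iota_uniq.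
  move=> h1 h2; have := pairwise_relI [rel x y | x != y] le L; rewrite h1 h2 /=.
  apply: sub_pairwise => e f /=; rewrite /le /place_order /lex_pair /=; lia.
exists s => t; rewrite standardizesE sz eqxx /=; apply/idP/eqP => [st|->]; last by rewrite sL.
apply: perm_word_inj; rewrite sL.
apply: (irr_sorted_eq (@place_order_trans u) (@place_order_irr u)) => //.
by move=> e; rewrite (perm_mem (perm_word_perm t)) (perm_mem Ln).
Qed.

(** The runs of equal letters of z mark the blocks of positions on which u has to increase
    weakly. *)
Definition weakly_rising (z u : seq nat) : bool :=
  (size u == size z) &&
  sorted (fun x y => (x.1 == y.1) ==> (x.2 <= y.2)%N) (zip z u).

(** The values i+1 and i+2 come in this order in w whenever they are in the same block of
    z. As the blocks are intervals, this says that w is a shuffle of increasing words. *)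
Definition shuffle (z w : seq nat) : bool :=
  all (fun i => (nth 0%N z i == nth 0%N z i.+1) ==>
         ([seq e <- w | (i.+1 <= e <= i.+2)%N] == [:: i.+1; i.+2])) (iota 0 (size z).-1).

(** In a stable sort, the position i precedes i+1 exactly when the letter at i is at most
    the one at i+1. *)
Lemma weakly_rising_shuffle n z u (s : 'S_n) : size z = n -> standardizes s u ->
  weakly_rising z u = shuffle z (perm_word s).
Proof.
move=> zn; rewrite standardizesE => /andP[/eqP un su]; rewrite /weakly_rising un zn eqxx /=.
have fE i : (i.+1 < n)%N ->
    ([seq e <- perm_word s | (i.+1 <= e <= i.+2)%N] == [:: i.+1; i.+2]) =
    (nth 0%N u i <= nth 0%N u i.+1)%N.
  move=> iN.
  have fs : sorted (place_order u) [seq e <- perm_word s | (i.+1 <= e <= i.+2)%N].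
    by apply: sorted_filter su; exact: place_order_trans.
  have fm e : (e \in [seq e <- perm_word s | (i.+1 <= e <= i.+2)%N]) = (e == i.+1) || (e == i.+2).
    by rewrite mem_filter (perm_mem (perm_word_perm s)) mem_iota; lia.
  have [le|lt] := leqP (nth 0%N u i) (nth 0%N u i.+1).
    apply/eqP; apply: (irr_sorted_eq (@place_order_trans u) (@place_order_irr u)) => //.
      by rewrite /= /place_order /lex_pair /=; lia.
    by move=> e; rewrite fm !inE.
  have -> : [seq e <- perm_word s | (i.+1 <= e <= i.+2)%N] = [:: i.+2; i.+1].
    apply: (irr_sorted_eq (@place_order_trans u) (@place_order_irr u)) => //.
      by rewrite /= /place_order /lex_pair /=; lia.
    by move=> e; rewrite fm !inE orbC.
  by rewrite eqseq_cons; lia.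
apply/(sortedP (0, 0)%N)/allP => H i.
  rewrite mem_iota zn => iN; have iN' : (i.+1 < n)%N by lia.
  by rewrite fE //; have := H i; rewrite size_zip zn un minnn !nth_zip ?zn //=; apply.
rewrite size_zip zn un minnn => iN; rewrite !nth_zip ?zn //= -fE //.
by apply: H; rewrite mem_iota zn; lia.
Qed.

Fixpoint blocks (c : nat) (a : seq nat) : seq nat :=
  if a is m :: a' then nseq m c ++ blocks c.+1 a' else [::].

Lemma blocks_ge c a : all (leq c) (blocks c a).
Proof.
elim: a c => //= m a IHa c; rewrite all_cat all_nseq leqnn orbT /=.
by apply: sub_all (IHa c.+1) => e; apply: ltnW.
Qed.

Lemma sorted_blocks_in m c z : sorted leq z -> all (fun e => c <= e < c + m)%N z ->
  exists a, z = blocks c a.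
Proof.
elim: m c z => [|m IHm] c z sz zP.
  by exists [::]; case: z zP {sz} => //= e z /andP[]; lia.
have [||a aE] := IHm c.+1 [seq e <- z | c != e].
- by apply: sorted_filter sz; exact: leq_trans.
- by rewrite all_filter; apply: sub_all zP => e /=; lia.
exists (count_mem c z :: a); rewrite /= -aE.
apply: (sorted_eq leq_trans anti_leq) => //.
  rewrite (sorted_pairwise leq_trans) pairwise_cat; apply/and3P; split.
  - apply/allrelP => e f /nseqP[-> _]; rewrite mem_filter => /andP[_]; by have := allP zP f; rewrite /= => H /H /andP[].
  - by rewrite -(sorted_pairwise leq_trans); elim: count => // -[|i] //= ->; rewrite leqnn.
  - by rewrite -(sorted_pairwise leq_trans); apply: sorted_filter sz; exact: leq_trans.
rewrite -(permPl (permEl (perm_filterC (pred1 c) z))).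
have -> : [seq e <- z | pred1 c e] = nseq (count_mem c z) c.
  rewrite -size_filter; apply/all_pred1P; exact: filter_all.
rewrite perm_cat2l; apply/seq.permP => p; congr count; apply: eq_filter => e /=.
by rewrite /= eq_sym.
Qed.

Lemma sorted_blocks z : sorted leq z -> exists a, z = blocks 0 a.
Proof.
move=> sz; apply: (@sorted_blocks_in (\max_(e <- z) e).+1) => //.
by apply/allP => e ez; rewrite add0n ltnS; apply: (@leq_bigmax_seq _ _ predT id).
Qed.

Lemma weakly_rising_cat m c z u : all (leq c.+1) z ->
  weakly_rising (nseq m c ++ z) u =
  [&& (m <= size u)%N, sorted leq (take m u) & weakly_rising z (drop m u)].
Proof.
move=> zc; rewrite /weakly_rising size_cat size_nseq size_drop.
have [mu|um] := leqP m (size u); last first.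
  by rewrite /=; case: eqP => // E; lia.
have -> : (size u == m + size z)%N = (size u - m == size z)%N by lia.
rewrite /= andbCA; congr andb.
rewrite -{1}(cat_take_drop m u) zip_cat ?size_nseq ?size_takel //.
have zipE : zip (nseq m c) (take m u) = [seq (c, e) | e <- take m u].
  have : size (take m u) = m by rewrite size_takel.
  by elim: m (take m u) {mu zc} => [|m IHm] [|e v] //= [/IHm->].
have -> : sorted leq (take m u) =
    sorted (fun x y => (x.1 == y.1) ==> (x.2 <= y.2)%N) (zip (nseq m c) (take m u)).
  by rewrite zipE sorted_map; apply: eq_sorted => e f /=; rewrite eqxx.
case: z zc => [|e z]; case: (drop m u) => [|f v] /=; rewrite ?cats0 ?andbT // => /andP[ce _].
have zipc x : x \in zip (nseq m c) (take m u) -> x.1 = c.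
  by rewrite zipE => /mapP[e' _ ->].
case: (zip (nseq m c) (take m u)) zipc => [|x l] zipc //=.
by rewrite cat_path /= zipc ?mem_last // (ltn_eqF ce).
Qed.

Section Products.
Variable k : comPzRingType.

(** A product of indicator series counts factorizations, and the degrees leave at most one
    of them. *)
Lemma prod_complete_sym c a : \prod_(m <- a) complete_sym k m =
  oddA_pi (fun u => (weakly_rising (blocks c a) u)%:R).
Proof.
elim: a c => [|m a IHa] c /=.
  rewrite big_nil; congr oddA_pi; apply/funext => u.
  by rewrite /weakly_rising; case: u => [|x u].
rewrite big_cons (IHa c.+1) -oddA_piM; congr oddA_pi; apply/funext => u.
rewrite weakly_rising_cat ?blocks_ge // /GRing.mul /= /nc_mul.
have [mu|um] /= := leqP m (size u); last first.
  rewrite big1 // => i _; rewrite size_take_min.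
  by have := ltn_ord i; case: eqP => [|_ _]; [lia | rewrite mul0r].
rewrite (bigD1 (Ordinal (mu : m < (size u).+1)%N)) //= big1 => [|i im].
  by rewrite addr0 size_takel // eqxx -natrM mulnb.
rewrite size_takel; last by rewrite -ltnS.
case: eqP => [E|_]; last by rewrite mul0r.
by case/eqP: im; apply: val_inj.
Qed.

(** Every word of length n is standardized by exactly one permutation. *)
Lemma rising_series_expansion n z : size z = n ->
  oddA_pi (fun u => (weakly_rising z u)%:R) =
  \sum_(s : 'S_n | shuffle z (perm_word s)) signed_fundamental k s.
Proof.
move=> zn; under eq_bigr do rewrite -standard_series.
rewrite -oddA_pi_sum; congr oddA_pi; apply/funext => u; rewrite sum_ncE.
have [un|un] := eqVneq (size u) n; last first.
  rewrite /weakly_rising zn (negbTE un) big1 // => s _.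
  by rewrite standardizesE (negbTE un).
have [s sE] := standardizes_ex un.
have su : standardizes s u by rewrite sE.
rewrite (weakly_rising_shuffle zn su) big_mkcond (bigD1 s) //= sE eqxx big1 ?addr0 => [|t ts].
  by case: shuffle.
by rewrite sE (negbTE ts) if_same.
Qed.
End Products.

(** * Classes of tableaux span the odd symmetric functions *)

Lemma shuffle_reading_tableau_of y z : size y = size z ->
  shuffle z (reading (tableau_of y)) <->
  (forall i, (i.+1 < size z)%N -> nth 0%N z i = nth 0%N z i.+1 ->
     (nth 0%N y i.+1 <= nth 0%N y i)%N).
Proof.
move=> yz; have fE i : (i.+1 < size z)%N ->
    ([seq e <- reading (tableau_of y) | (i.+1 <= e <= i.+2)%N] == [:: i.+1; i.+2]) =
    (nth 0%N y i.+1 <= nth 0%N y i)%N.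
  move=> iN; have [le|lt] := leqP (nth 0%N y i.+1) (nth 0%N y i).
    apply/eqP/filter_reading_tableau_of; first by rewrite /= /reading_order /=; lia.
    by move=> e; rewrite !inE yz; lia.
  rewrite (@filter_reading_tableau_of _ _ [:: i.+2; i.+1]).
  - by rewrite eqseq_cons; lia.
  - by rewrite /= /reading_order /=; lia.
  - by move=> e; rewrite !inE yz; lia.
split=> [/allP H i iz zE | H].
  by rewrite -fE //; have := H i; rewrite mem_iota zE eqxx /=; apply; lia.
apply/allP => i; rewrite mem_iota => iz; apply/implyP => /eqP zE.
by rewrite fE ?H //; lia.
Qed.

Lemma shuffle_schensted z w : uniq w -> shuffle z (reading (schensted w)) = shuffle z w.
Proof. by move=> uw; apply: eq_all => i; rewrite schensted_pair. Qed.

Section Main.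
Variable k : comPzRingType.

Lemma sum_if_eq (V : nmodType) (T : eqType) (r : seq T) (x : T) (c : T -> V) : uniq r ->
  \sum_(t <- r) (if x == t then c t else 0) = if x \in r then c x else 0.
Proof.
elim: r => [|y r IHr] /=; first by rewrite big_nil.
case/andP => yr ur; rewrite big_cons IHr // inE.
by have [->|] := eqVneq x y; rewrite ?(negbTE yr) ?addr0 ?add0r.
Qed.

Lemma varsigmaE n T : size (flatten T) = n ->
  varsigma k T = \sum_(s : 'S_n | schensted (perm_word s) == T) signed_fundamental k s.
Proof.
move=> <-; rewrite /varsigma /tableau_sum linear_sum; apply: eq_bigr => s _.
by rewrite linearZ /= pi'_perm.
Qed.

Lemma varsigma_class T : is_syt T ->
  varsigma k T = tableau_class k (size (row_word T)) (row_word T).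
Proof.
by move=> sT; rewrite (@varsigmaE _ T (esym (size_row_word T))) /tableau_class -syt_tableau_of.
Qed.

(** The shuffles form a union of fibres of P, because the condition can be checked on the
    reading word of P(w). *)
Lemma prod_complete_varsigma a : exists Ts : seq (seq (seq nat)),
  [/\ uniq Ts,
      forall T, T \in Ts -> is_syt T /\ size (row_word T) = size (blocks 0 a) /\
                            shuffle (blocks 0 a) (reading T),
      forall s : 'S_(size (blocks 0 a)),
        shuffle (blocks 0 a) (reading (schensted (perm_word s))) ->
        schensted (perm_word s) \in Ts
    & \prod_(m <- a) complete_sym k m = \sum_(T <- Ts) varsigma k T].
Proof.
set z := blocks 0 a; set n := size z.
pose P (s : 'S_n) := schensted (perm_word s).
have PshufE s : shuffle z (reading (P s)) = shuffle z (perm_word s).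
  by rewrite shuffle_schensted ?perm_word_uniq.
have Psyt s : is_syt (P s) by apply: schensted_syt (perm_word_perm s).
have Psz s : size (flatten (P s)) = n.
  rewrite -(perm_size (reading_flatten _)) (perm_size (schensted_perm _)).
  exact: size_perm_word.
exists (undup [seq P s | s <- enum 'S_n & shuffle z (perm_word s)]); set Ts := undup _.
have PTs s : (P s \in Ts) = shuffle z (perm_word s).
  rewrite mem_undup; apply/mapP/idP => [[t]|sz].
    by rewrite mem_filter -!PshufE => /andP[ts _] ->.
  by exists s; rewrite // mem_filter sz mem_enum inE.
have TsP T : T \in Ts -> exists s, T = P s.
  by rewrite mem_undup => /mapP[s _ ->]; exists s.
split.
- exact: undup_uniq.
- move=> T TT; have [s TE] := TsP T TT; rewrite TE in TT *.
  by rewrite size_row_word Psz PshufE -PTs TT.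
- by move=> s; rewrite PshufE -PTs.
rewrite (prod_complete_sym k 0) -/z (rising_series_expansion k (erefl n)).
rewrite (eq_big_seq (fun T => \sum_(s : 'S_n) if P s == T then signed_fundamental k s else 0)).
  rewrite exchange_big big_mkcond; apply: eq_bigr => s _ /=.
  by rewrite (sum_if_eq _ (fun=> signed_fundamental k s)) ?undup_uniq // PTs.
by move=> T /TsP[s ->]; rewrite (varsigmaE (Psz s)) big_mkcond.
Qed.

Lemma OSym_subalgebra : is_subalgebra (OSym k).
Proof.
split.
- by move=> B [[]].
- by move=> c u v uO vO B BP; have [[_ BD _] _] := BP; apply: BD; [exact: uO | exact: vO].
- by move=> u v uO vO B BP; have [[_ _ BM] _] := BP; apply: BM; [exact: uO | exact: vO].
Qed.

Lemma OSym0 : OSym k 0.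
Proof.
have [O1 OD _] := OSym_subalgebra.
by have := OD (-1) 1 1 O1 O1; rewrite scaleN1r addNr.
Qed.

Lemma OSymD u v : OSym k u -> OSym k v -> OSym k (u + v).
Proof. by have [_ OD _] := OSym_subalgebra => uO vO; rewrite -[u]scale1r; apply: OD. Qed.

Lemma OSymZ c u : OSym k u -> OSym k (c *: u).
Proof. by have [_ OD _] := OSym_subalgebra => uO; rewrite -[_ *: _]addr0; apply: OD OSym0. Qed.

Lemma OSym_opp u : OSym k (- u) <-> OSym k u.
Proof. by split=> uO; [rewrite -[u]opprK|]; rewrite -scaleN1r; apply: OSymZ. Qed.

Lemma OSym_sum (I : eqType) (r : seq I) (F : I -> oddA k) :
  (forall i, i \in r -> OSym k (F i)) -> OSym k (\sum_(i <- r) F i).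
Proof.
move=> FO; rewrite big_seq.
by apply: (big_ind (OSym k)) => //; [exact: OSym0 | exact: OSymD].
Qed.

Lemma OSym_complete n : OSym k (complete_sym k n).
Proof.
case: n => [|n]; last by move=> B [_ BG]; apply: BG; exists n.+1.
have [O1 _ _] := OSym_subalgebra.
suff -> : complete_sym k 0 = 1 by [].
by congr oddA_pi; apply/funext => -[|x w].
Qed.

Lemma OSym_prod a : OSym k (\prod_(m <- a) complete_sym k m).
Proof.
have [O1 _ OM] := OSym_subalgebra.
by apply: (big_ind (OSym k)) => // m _; apply: OSym_complete.
Qed.

(** Induction on the sum of the letters. By connectedness y may be replaced with the
    sorted word z of the same content. In the expansion of the product of the h_m, for
    m the multiplicities in z, the class of z occurs once and the other classes have
    row words of smaller sum. *)
Lemma lattice_class_OSym y : lattice_word y -> OSym k (tableau_class k (size y) y).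
Proof.
have [m] := ubnP (sumn y); elim: m y => // m IHm y ym ly.
pose O y := OSym k (tableau_class k (size y) y).
have Omove p u v t q : (t <= u < v)%N ->
    O (p ++ [:: u; v; t] ++ q) <-> O (p ++ [:: u; t; v] ++ q).
  move=> tuv; rewrite /O tableau_class_move //.
  have -> : size (p ++ [:: u; t; v] ++ q) = size (p ++ [:: u; v; t] ++ q) by rewrite !size_cat.
  exact: OSym_opp.
have := lattice_words_connected Omove ly [::]; rewrite !cats0 => Oy; apply/Oy; rewrite /O.
set z := sort leq y; have sz : sorted leq z by apply: sort_sorted leq_total _.
have zm : (sumn z < m.+1)%N.
  by rewrite (perm_sumn (permEl (perm_sort leq y))).
have [[s0 s0E] | none] :=
  pselect (exists s : 'S_(size z), schensted (perm_word s) = tableau_of z); last first.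
  (* When no permutation inserts to this tableau, its class is an empty sum. *)
  rewrite /tableau_class big1; first exact: OSym0.
  by move=> s /eqP sE; case: none; exists s.
have zz : shuffle z (reading (tableau_of z)) by apply/shuffle_reading_tableau_of => // i _ ->.
have [a zE] := sorted_blocks sz.
have [Ts [uTs TsP Ts_in prodE]] := prod_complete_varsigma a.
have : tableau_of z \in Ts.
  by move: s0 s0E Ts_in zz; rewrite zE => s0 s0E Ts_in zz; rewrite -s0E; apply: Ts_in; rewrite s0E.
move=> zT; have [zsyt [zsize _]] := TsP _ zT.
have varz : varsigma k (tableau_of z) = tableau_class k (size z) z.
  by rewrite (@varsigmaE (size z)) // -size_row_word zsize -zE.
have := OSym_prod a; rewrite prodE (bigD1_seq (tableau_of z)) //= varz => Osum.
rewrite -[tableau_class _ _ _](addrK (\sum_(T <- Ts | T != tableau_of z) varsigma k T)).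
apply: OSymD => //; apply/OSym_opp; rewrite -big_filter; apply: OSym_sum => T.
rewrite mem_filter => /andP[Tz /TsP[Tsyt [Tsize Tshuf]]].
rewrite varsigma_class //; apply: IHm; last exact: syt_lattice_word.
rewrite -zE in Tsize Tshuf; rewrite (syt_tableau_of Tsyt) in Tshuf Tz.
have Tle := lattice_word_le_sorted (syt_lattice_word Tsyt) sz Tsize ((shuffle_reading_tableau_of Tsize).1 Tshuf).
have [E|lt] := sumn_lt_nth Tsize Tle; first by rewrite E eqxx in Tz.
by move: zm; rewrite ltnS; apply: leq_trans.
Qed.

Lemma varsigma_OSym T : is_syt T -> OSym k (varsigma k T).
Proof. by move=> sT; rewrite varsigma_class //; apply: lattice_class_OSym; apply: syt_lattice_word. Qed.

Lemma pi'_sum (Ts : seq (seq (seq nat))) (a : seq (seq nat) -> k) :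
  pi' k (\sum_(T <- Ts) a T *: tableau_sum (-1) T) = \sum_(T <- Ts) a T *: varsigma k T.
Proof. by rewrite linear_sum; apply: eq_bigr => T _; rewrite linearZ. Qed.

(** Moves a combination over a list with repetitions to a larger list without, so that two
    combinations can be added. *)
Lemma sum_count (V : lmodType k) (T : eqType) (r R : seq T) (a : T -> k) (F : T -> V) :
  uniq R -> {subset r <= R} ->
  \sum_(t <- r) a t *: F t = \sum_(t <- R) (a t *+ count_mem t r) *: F t.
Proof.
move=> uR; elim: r => [|x r IHr] rR.
  by rewrite big_nil big1 // => t _; rewrite mulr0n scale0r.
rewrite big_cons IHr; last by move=> t tr; apply: rR; rewrite inE tr orbT.
have xR : x \in R by apply: rR; rewrite mem_head.
have -> : a x *: F x = \sum_(t <- R) (if x == t then a t *: F t else 0) by rewrite sum_if_eq ?xR.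
rewrite -big_split; apply: eq_bigr => t _ /=.
by case: (x == t); rewrite ?add0r ?add0n // mulrS scalerDl.
Qed.

Lemma PR'_linear c f g : PR' (-1 : k) f -> PR' (-1 : k) g -> PR' (-1 : k) (c *: f + g).
Proof.
move=> [Ts [a [syT ->]]] [Us [b [syU ->]]].
pose R := undup (Ts ++ Us).
exists R, (fun T => c * (a T *+ count_mem T Ts) + b T *+ count_mem T Us); split.
  by apply/allP => T; rewrite mem_undup mem_cat => /orP[/(allP syT)|/(allP syU)].
have TR : {subset Ts <= R} by move=> T TT; rewrite mem_undup mem_cat TT.
have UR : {subset Us <= R} by move=> T TT; rewrite mem_undup mem_cat TT orbT.
rewrite (sum_count a _ (undup_uniq _) TR) (sum_count b _ (undup_uniq _) UR).
rewrite scaler_sumr -big_split; apply: eq_bigr => T _ /=.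
by rewrite scalerDl scalerA.
Qed.

Definition complete_span (u : oddA k) : Prop :=
  exists L : seq (k * seq nat),
    u = \sum_(p <- L) p.1 *: \prod_(m <- p.2) complete_sym k m.

Lemma complete_span_subalgebra : is_subalgebra complete_span.
Proof.
split.
- by exists [:: (1, [::])]; rewrite big_seq1 big_nil scale1r.
- move=> c _ _ [L ->] [M ->]; exists ([seq (c * p.1, p.2) | p <- L] ++ M).
  rewrite big_cat big_map scaler_sumr; congr (_ + _).
  by apply: eq_bigr => p _; rewrite scalerA.
move=> _ _ [L ->] [M ->]; exists [seq (p.1 * q.1, p.2 ++ q.2) | p <- L, q <- M].
rewrite big_allpairs_dep mulr_suml; apply: eq_bigr => p _.
rewrite mulr_sumr; apply: eq_bigr => q _.
by rewrite big_cat -oddA_scalerAl -oddA_scalerAr scalerA.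
Qed.

Lemma OSym_complete_span u : OSym k u -> complete_span u.
Proof.
move=> uO; apply: uO; split; first exact: complete_span_subalgebra.
move=> _ [n _ ->]; exists [:: (1, [:: n])].
by rewrite !big_seq1 scale1r.
Qed.

Lemma complete_span_image u : complete_span u -> exists2 f, PR' (-1 : k) f & pi' k f = u.
Proof.
move=> [L ->]; elim: L => [|[c a] L [f fP fE]].
  by exists 0; [exists [::], (fun=> 0); rewrite big_nil | rewrite big_nil linear0].
have [Ts [_ TsP _ prodE]] := prod_complete_varsigma a.
exists (c *: (\sum_(T <- Ts) 1 *: tableau_sum (-1) T) + f).
  apply: PR'_linear => //; exists Ts, (fun=> 1); split=> //.
  by apply/allP => T /TsP[].
rewrite linearP /= pi'_sum fE big_cons /= prodE; congr (_ *: _ + _).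
by apply: eq_bigr => T _; rewrite scale1r.
Qed.
End Main.

Theorem theorem5p2 (k : comPzRingType) :
  (forall T : seq (seq nat), is_syt T -> OSym k (varsigma k T)) /\
  (set_fun (PR' (-1 : k)) (OSym k) (pi' k) /\
   set_surj (PR' (-1 : k)) (OSym k) (pi' k)).
Proof.
split; first exact: varsigma_OSym.
split.
  move=> _ [Ts [a [syT ->]]]; rewrite pi'_sum; apply: OSym_sum => T /(allP syT) sT.
  by apply: OSymZ; apply: varsigma_OSym.
move=> u /OSym_complete_span/complete_span_image[f fP fE].
by exists f.
Qed.
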